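(* Let $\mathbb{K}$ be an algebraically closed field of characteristic different from $2$, let $q\in\mathbb{K}^*\setminus\{\pm1\}$ with $q+q^{-1}\neq0$, and let $\mathcal{H}(n)$ be the Hecke-Clifford algebra over $\mathbb{K}$. Suppose that $q$ is not a primitive $4l$-th root of unity for any $l\in\{1,\dots,n\}$. Then $\mathcal{H}(n)$ is a symmetric superalgebra with symmetrizing form $$t_{1,n}:=\tau_{1,n}\bigl(-\cdot(1+X_1)(1+X_2)\cdots(1+X_n)\bigr).$$
   Context: A finite-dimensional superalgebra $\mathcal{A}$ over $\mathbb{K}$ is symmetric with symmetrizing form $t:\mathcal{A}\to\mathbb{K}$ if $t$ is linear, vanishes on odd elements, is non-degenerate (the matrix $(t(b_1b_2))$ over a homogeneous basis is invertible) and satisfies $t(xy)=t(yx)$ for all $x,y$. Put $\epsilon=q-q^{-1}$. The affine Hecke-Clifford algebra $\mathcal{H}_c(n)$ is the $\mathbb{K}$-superalgebra with even generators $T_1,\dots,T_{n-1},X_1^{\pm1},\dots,X_n^{\pm1}$, odd generators $C_1,\dots,C_n$ and relations: $T_i^2=\epsilon T_i+1$; $T_iT_j=T_jT_i$ for $|i-j|>1$; $T_iT_{i+1}T_i=T_{i+1}T_iT_{i+1}$; $X_iX_j=X_jX_i$, $X_iX_i^{-1}=X_i^{-1}X_i=1$; $C_i^2=1$, $C_iC_j=-C_jC_i$ for $i\ne j$; $T_iX_i=X_{i+1}T_i-\epsilon(X_{i+1}+C_iC_{i+1}X_i)$; $T_iX_{i+1}=X_iT_i+\epsilon(1-C_iC_{i+1})X_{i+1}$;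 $T_iX_j=X_jT_i$ for $j\ne i,i+1$; $T_iC_i=C_{i+1}T_i$; $T_iC_{i+1}=C_iT_i-\epsilon(C_i-C_{i+1})$; $T_iC_j=C_jT_i$ for $j\ne i,i+1$; $X_iC_i=C_iX_i^{-1}$; $X_iC_j=C_jX_i$ for $i\neq j$. The Hecke-Clifford algebra is $\mathcal{H}(n)=\mathcal{H}_c(n)/\langle X_1-1\rangle$; it has basis $C^\beta T_w$, $\beta\in\mathbb{Z}_2^n$, $w\in\mathfrak{S}_n$, and $X_i$ also denotes the image of $X_i$ in $\mathcal{H}(n)$. There is a decomposition $\mathcal{H}(n)=\mathcal{H}(n-1)T_{n-1}\mathcal{H}(n-1)\oplus\mathcal{H}(n-1)\oplus C_n\mathcal{H}(n-1)$ (first summand absent for $n=1$; $\mathcal{H}(0)=\mathbb{K}$). Let $\varepsilon_n:\mathcal{H}(n)\to\mathcal{H}(n-1)$ be the projection onto the summand $\mathcal{H}(n-1)$, and $\tau_{1,n}=\varepsilon_1\circ\cdots\circ\varepsilon_n$. The notation $\tau_{1,n}(-\cdot z)$ means $h\mapsto\tau_{1,n}(hz)$. *)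

(* Defs.v *)
From HB Require Import structures.
From mathcomp Require Import all_boot all_order all_algebra.
From mathcomp Require Import boolp classical_sets.
From mathcomp Require Import finmap.
From mathcomp.multinomials Require Import monalg.

Set Implicit Arguments.
Unset Strict Implicit.
Unset Printing Implicit Defensive.

Import GRing.Theory.
Local Open Scope ring_scope.

(* An algebra presented by generators and relations may a priori be zero,      *)
(* while [algType] requires 1 != 0.  Hence K-algebras are taken here to be     *)
(* rings, possibly zero, with a ring morphism from K to their center; scalar   *)
(* multiplication is [scal a * x].                                             *)
HB.mixin Record isCentralAlgebra (K : comPzRingType) A of GRing.PzRing A := {
  scal : {rmorphism K -> A};
  scalC : forall (a : K) (x : A), scal a * x = x * scal a
}.

#[short(type="centralAlgType")]
HB.structure Definition CentralAlgebra (K : comPzRingType) :=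
  {A of GRing.PzRing A & isCentralAlgebra K A}.

Section Symmetric.
Variables (K : fieldType) (A : centralAlgType K).
Implicit Type gr : bool -> A -> Prop.

(* [gr false x]: x is even; [gr true x]: x is odd *)
Record super_grading gr : Prop := {
  super0 : forall b, gr b 0;
  superD : forall b x y, gr b x -> gr b y -> gr b (x + y);
  superZ : forall b a x, gr b x -> gr b (scal a * x);
  super1 : gr false 1;
  superM : forall b c x y, gr b x -> gr c y -> gr (b (+) c) (x * y);
  super_sum : forall x, exists x0 x1, [/\ gr false x0, gr true x1 & x = x0 + x1];
  super_direct : forall x, gr false x -> gr true x -> x = 0
}.

Definition homogeneous_basis gr d (b : 'I_d -> A) : Prop :=
  (forall i, exists s, gr s (b i)) /\
  (forall x, exists! c : 'rV[K]_d, x = \sum_i scal (c 0 i) * b i).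

Record symmetrizing_form gr (t : A -> K) : Prop := {
  sym_additive : forall x y, t (x + y) = t x + t y;
  sym_scalable : forall a x, t (scal a * x) = a * t x;
  sym_odd : forall x, gr true x -> t x = 0;
  sym_nondegenerate : forall d (b : 'I_d -> A), homogeneous_basis gr b ->
    \matrix_(i, j) t (b i * b j) \in unitmx;
  sym_trace : forall x y, t (x * y) = t (y * x)
}.

Definition symmetric_superalgebra gr (t : A -> K) : Prop :=
  [/\ super_grading gr,
      exists d (b : 'I_d -> A), homogeneous_basis gr b
    & symmetrizing_form gr t].

End Symmetric.

Section QuotientAlgebra.
Variables (K : fieldType) (A : centralAlgType K) (S : A -> Prop).

Inductive ideal_gen : A -> Prop :=
| ideal_gen_in a s b : S s -> ideal_gen (a * s * b)
| ideal_gen0 : ideal_gen 0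
| ideal_genD x y : ideal_gen x -> ideal_gen y -> ideal_gen (x + y).

Lemma ideal_genMl a x : ideal_gen x -> ideal_gen (a * x).
Proof.
elim=> [c s b Ss||y z _ Iy _ Iz]; last by rewrite mulrDr; apply: ideal_genD.
  by rewrite !mulrA; apply: ideal_gen_in.
by rewrite mulr0; apply: ideal_gen0.
Qed.

Lemma ideal_genMr a x : ideal_gen x -> ideal_gen (x * a).
Proof.
elim=> [c s b Ss||y z _ Iy _ Iz]; last by rewrite mulrDl; apply: ideal_genD.
  by rewrite -mulrA; apply: ideal_gen_in.
by rewrite mul0r; apply: ideal_gen0.
Qed.

Definition ideal : {pred A} := fun x => `[< ideal_gen x >].

Lemma idealP x : reflect (ideal_gen x) (x \in ideal).
Proof. exact: asboolP. Qed.

Lemma ideal_zmod_closed : zmod_closed ideal.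
Proof.
split=> [|x y /idealP Ix /idealP Iy]; apply/idealP; first exact: ideal_gen0.
by apply: ideal_genD => //; rewrite -mulN1r; apply: ideal_genMl.
Qed.

HB.instance Definition _ := GRing.isZmodClosed.Build A ideal ideal_zmod_closed.

Definition quot_alg : Type := @Quotient.quot A ideal.

HB.instance Definition _ := GRing.Zmodule.on quot_alg.
HB.instance Definition _ := EqQuotient.on quot_alg.

Definition quot_pi (x : A) : quot_alg := \pi_(quot_alg)%qT x.

Lemma quot_piK x : quot_pi (repr x) = x.
Proof. exact: reprK. Qed.

Lemma quot_piP x y : quot_pi x = quot_pi y <-> ideal_gen (x - y).
Proof.
rewrite /quot_pi; split=> [/eqP|Ixy].
  by rewrite -Quotient.idealrBE => /idealP.
by apply/eqP; rewrite -Quotient.idealrBE; apply/idealP.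
Qed.

Lemma ideal_gen_repr x : ideal_gen (x - repr (quot_pi x)).
Proof. by apply/quot_piP; rewrite quot_piK. Qed.

Lemma quot_pi_is_additive : {morph quot_pi : x y / x - y}.
Proof. by move=> x y; rewrite /quot_pi Quotient.pi_add Quotient.pi_opp. Qed.

Definition quot_mul (x y : quot_alg) : quot_alg := quot_pi (repr x * repr y).

Lemma quot_piM x y : quot_pi (x * y) = quot_mul (quot_pi x) (quot_pi y).
Proof.
apply/quot_piP; set x' := repr (quot_pi x); set y' := repr (quot_pi y).
have ->: x * y - x' * y' = (x - x') * y + x' * (y - y').
  by rewrite mulrBl mulrBr addrA subrK.
by apply: ideal_genD; [apply: ideal_genMr|apply: ideal_genMl];
   exact: ideal_gen_repr.
Qed.

Lemma quot_piD x y : quot_pi (x + y) = quot_pi x + quot_pi y.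
Proof. by rewrite /quot_pi Quotient.pi_add. Qed.

Lemma quot_mulA : associative quot_mul.
Proof.
by move=> x y z; rewrite -(quot_piK x) -(quot_piK y) -(quot_piK z) -!quot_piM mulrA.
Qed.

Lemma quot_mul1l : left_id (quot_pi 1) quot_mul.
Proof. by move=> x; rewrite -(quot_piK x) -quot_piM mul1r. Qed.

Lemma quot_mul1r : right_id (quot_pi 1) quot_mul.
Proof. by move=> x; rewrite -(quot_piK x) -quot_piM mulr1. Qed.

Lemma quot_mulDl : left_distributive quot_mul +%R.
Proof.
move=> x y z; rewrite -(quot_piK x) -(quot_piK y) -(quot_piK z).
by rewrite -quot_piD -!quot_piM -quot_piD mulrDl.
Qed.

Lemma quot_mulDr : right_distributive quot_mul +%R.
Proof.
move=> x y z; rewrite -(quot_piK x) -(quot_piK y) -(quot_piK z).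
by rewrite -quot_piD -!quot_piM -quot_piD mulrDr.
Qed.

HB.instance Definition _ := GRing.Zmodule_isPzRing.Build quot_alg
  quot_mulA quot_mul1l quot_mul1r quot_mulDl quot_mulDr.

Lemma quot_pi_is_monoid_morphism : monoid_morphism quot_pi.
Proof. by split=> // x y; rewrite quot_piM. Qed.

HB.instance Definition _ :=
  GRing.isZmodMorphism.Build A quot_alg quot_pi quot_pi_is_additive.
HB.instance Definition _ :=
  GRing.isMonoidMorphism.Build A quot_alg quot_pi quot_pi_is_monoid_morphism.

Lemma quot_scalC (a : K) (x : quot_alg) :
  (quot_pi \o scal) a * x = x * (quot_pi \o scal) a.
Proof. by rewrite -(quot_piK x) /= -!rmorphM scalC. Qed.

HB.instance Definition _ := isCentralAlgebra.Build K quot_alg quot_scalC.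

Definition quot_lift (B : Type) (f : A -> B) (x : quot_alg) : B := f (repr x).

Lemma quot_liftE (B : pzRingType) (f : {rmorphism A -> B}) :
  (forall s, S s -> f s = 0) -> forall x, quot_lift f (quot_pi x) = f x.
Proof.
move=> fS x; apply/esym/eqP; rewrite -subr_eq0 -rmorphB; apply/eqP.
elim: (ideal_gen_repr x) => [a s b /fS fs||y z _ fy _ fz].
- by rewrite !rmorphM fs mulr0 mul0r.
- exact: rmorph0.
- by rewrite rmorphD fy fz addr0.
Qed.

Lemma quot_lift_rmorphism (B : pzRingType) (f : {rmorphism A -> B}) :
  (forall s, S s -> f s = 0) ->
  exists g : {rmorphism quot_alg -> B}, quot_lift f =1 g.
Proof.
move=> fS; have fE := quot_liftE fS.
have fB : {morph quot_lift f : x y / x - y}.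
  by move=> x y; rewrite -(quot_piK x) -(quot_piK y) -rmorphB !fE rmorphB.
have fM : monoid_morphism (quot_lift f).
  split=> [|x y]; first by rewrite -(rmorph1 quot_pi) fE rmorph1.
  by rewrite -(quot_piK x) -(quot_piK y) -rmorphM !fE rmorphM.
pose gB := GRing.isZmodMorphism.Build _ _ _ fB.
pose gM := GRing.isMonoidMorphism.Build _ _ _ fM.
pose g : {rmorphism quot_alg -> B} := HB.pack (quot_lift f) gB gM.
by exists g.
Qed.

End QuotientAlgebra.

Notation free_alg K G := {malg K[{fmonom G}]}.

Section FreeAlgebra.
Variables (K : fieldType) (G : choiceType).

Lemma free_scalC (a : K) (x : free_alg K G) : a%:MP * x = x * a%:MP.
Proof.
rewrite !malgM_def fgmulUg fgmulgU; apply: eq_bigr => w _.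
by rewrite mulrC mul1m mulm1.
Qed.

HB.instance Definition _ := isCentralAlgebra.Build K (free_alg K G) free_scalC.

Definition free_gen (g : G) : free_alg K G := << fmu g >>.

Variables (A : centralAlgType K) (f : G -> A).

(* the algebra morphism extending f *)
Definition free_lift (x : free_alg K G) : A :=
  \sum_(w <- msupp x) scal x@_w * \prod_(g <- (w : seq G)) f g.

Lemma free_liftEw (d : {fset {fmonom G}}) x : (msupp x `<=` d)%fset ->
  free_lift x = \sum_(w <- d) scal x@_w * \prod_(g <- (w : seq G)) f g.
Proof.
move=> le_xd; rewrite [LHS](big_fset_incl _ le_xd) => //= w _ /mcoeff_outdom ->.
by rewrite rmorph0 mul0r.
Qed.

Lemma free_liftU c w :
  free_lift << c *g w >> = scal c * \prod_(g <- (w : seq G)) f g.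
Proof. by rewrite (free_liftEw msuppU_le) big_seq_fset1 mcoeffUU. Qed.

Lemma free_lift_gen g : free_lift (free_gen g) = f g.
Proof. by rewrite free_liftU rmorph1 mul1r fmU big_seq1. Qed.

Lemma free_lift_is_additive : {morph free_lift : x y / x - y}.
Proof.
move=> x y; pose d := (msupp x `|` msupp y)%fset.
rewrite (free_liftEw (msuppB_le x y)) (@free_liftEw d x) ?fsubsetUl //.
rewrite (@free_liftEw d y) ?fsubsetUr // -sumrB; apply: eq_bigr => w _.
by rewrite mcoeffB rmorphB mulrBl.
Qed.

HB.instance Definition _ :=
  GRing.isZmodMorphism.Build (free_alg K G) A free_lift free_lift_is_additive.

Lemma free_lift_is_monoid_morphism : monoid_morphism free_lift.
Proof.
split=> [|x y]; first by rewrite free_liftU rmorph1 mul1r fm1 big_nil.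
rewrite malgME raddf_sum mulr_suml; apply: eq_bigr => v _.
rewrite raddf_sum mulr_sumr; apply: eq_bigr => w _ /=.
rewrite free_liftU fmM big_cat rmorphM -!mulrA; congr (_ * _).
by rewrite !mulrA scalC.
Qed.

HB.instance Definition _ := GRing.isMonoidMorphism.Build
  (free_alg K G) A free_lift free_lift_is_monoid_morphism.

Lemma free_lift_scal a : free_lift (scal a) = scal a.
Proof. by rewrite free_liftU fm1 big_nil mulr1. Qed.

End FreeAlgebra.

Section Generators.
Variable n : nat.

(* [HT i] stands for T_(i+1), which exchanges the strands i and i+1 (counted   *)
(* from 0), [HX i], [HXV i], [HC i] for X_(i+1), its inverse and C_(i+1).      *)
Inductive hc_gen : Type :=
| HT of 'I_n.-1
| HX of 'I_n
| HXV of 'I_n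
| HC of 'I_n.

Definition hc_gen_code (g : hc_gen) : 'I_n.-1 + ('I_n + ('I_n + 'I_n)) :=
  match g with
  | HT i => inl i
  | HX i => inr (inl i)
  | HXV i => inr (inr (inl i))
  | HC i => inr (inr (inr i))
  end.

Definition hc_gen_decode (c : 'I_n.-1 + ('I_n + ('I_n + 'I_n))) : hc_gen :=
  match c with
  | inl i => HT i
  | inr (inl i) => HX i
  | inr (inr (inl i)) => HXV i
  | inr (inr (inr i)) => HC i
  end.

Lemma hc_gen_codeK : cancel hc_gen_code hc_gen_decode.
Proof. by case. Qed.

HB.instance Definition _ := Choice.copy hc_gen (can_type hc_gen_codeK).

Definition hc_gen_parity (g : hc_gen) : bool := if g is HC _ then true else false.

Definition strandl (i : 'I_n.-1) : 'I_n := widen_ord (leq_pred n) i.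

Lemma strandr_subproof (i : 'I_n.-1) : (i.+1 < n)%N.
Proof. by rewrite -ltn_predRL. Qed.

Definition strandr (i : 'I_n.-1) : 'I_n := Ordinal (strandr_subproof i).

End Generators.

Section HeckeClifford.
Variables (K : fieldType) (q : K).

Section Relations.
Variables (n : nat) (A : centralAlgType K) (gen : hc_gen n -> A).

Local Notation T i := (gen (HT i)).
Local Notation X i := (gen (HX i)).
Local Notation XV i := (gen (HXV i)).
Local Notation C i := (gen (HC i)).
Local Notation eps := (scal (q - q^-1) : A).

Inductive ahc_rel : A -> A -> Prop :=
| ahc_TT i : ahc_rel (T i ^+ 2) (eps * T i + 1)
| ahc_Tcomm (i j : 'I_n.-1) : (i.+1 < j)%N || (j.+1 < i)%N ->
    ahc_rel (T i * T j) (T j * T i)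
| ahc_braid (i j : 'I_n.-1) : j = i.+1 :> nat ->
    ahc_rel (T i * T j * T i) (T j * T i * T j)
| ahc_XX i j : ahc_rel (X i * X j) (X j * X i)
| ahc_XXV i : ahc_rel (X i * XV i) 1
| ahc_XVX i : ahc_rel (XV i * X i) 1
| ahc_CC i : ahc_rel (C i ^+ 2) 1
| ahc_Canti i j : i != j -> ahc_rel (C i * C j) (- (C j * C i))
| ahc_TXl i (a := strandl i) (b := strandr i) :
    ahc_rel (T i * X a) (X b * T i - eps * (X b + C a * C b * X a))
| ahc_TXr i (a := strandl i) (b := strandr i) :
    ahc_rel (T i * X b) (X a * T i + eps * ((1 - C a * C b) * X b))
| ahc_TX i j : j != strandl i -> j != strandr i -> ahc_rel (T i * X j) (X j * T i)
| ahc_TCl i (a := strandl i) (b := strandr i) : ahc_rel (T i * C a) (C b * T i)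
| ahc_TCr i (a := strandl i) (b := strandr i) :
    ahc_rel (T i * C b) (C a * T i - eps * (C a - C b))
| ahc_TC i j : j != strandl i -> j != strandr i -> ahc_rel (T i * C j) (C j * T i)
| ahc_XC i : ahc_rel (X i * C i) (C i * XV i)
| ahc_XCcomm i j : i != j -> ahc_rel (X i * C j) (C j * X i).

End Relations.

Lemma ahc_rel_morph n (A B : centralAlgType K) (f : {rmorphism A -> B})
    (gen : hc_gen n -> A) (gen' : hc_gen n -> B) u v :
  (forall a, f (scal a) = scal a) -> (forall g, f (gen g) = gen' g) ->
  ahc_rel gen u v -> ahc_rel gen' (f u) (f v).
Proof.
move=> fs fg; have fE := (fs, fg, rmorphXn f, rmorphM f, rmorphB f, rmorphD f,
  rmorphN f, rmorph1 f).
by case=> *; rewrite !fE; constructor.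
Qed.

Lemma ahc_rel_morph_eq n (A B : centralAlgType K) (f : {rmorphism A -> B})
    (gen : hc_gen n -> A) (gen' : hc_gen n -> B) :
  (forall a, f (scal a) = scal a) -> (forall g, f (gen g) = gen' g) ->
  (forall u v, ahc_rel gen u v -> f u = f v) ->
  forall u v, ahc_rel gen' u v -> u = v.
Proof.
move=> fs fg H u v; have fE := (fs, fg, rmorphXn f, rmorphM f, rmorphB f,
  rmorphD f, rmorphN f, rmorph1 f).
case=> [i|i j ij|i j ij|i j|i|i|i|i j ij|i a b|i a b|i j ja jb|i a b|i a b
  |i j ja jb|i|i j ij].
- by move: (H _ _ (ahc_TT gen i)); rewrite !fE.
- by move: (H _ _ (ahc_Tcomm gen ij)); rewrite !fE.
- by move: (H _ _ (ahc_braid gen ij)); rewrite !fE.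
- by move: (H _ _ (ahc_XX gen i j)); rewrite !fE.
- by move: (H _ _ (ahc_XXV gen i)); rewrite !fE.
- by move: (H _ _ (ahc_XVX gen i)); rewrite !fE.
- by move: (H _ _ (ahc_CC gen i)); rewrite !fE.
- by move: (H _ _ (ahc_Canti gen ij)); rewrite !fE.
- by move: (H _ _ (ahc_TXl gen i)); rewrite !fE.
- by move: (H _ _ (ahc_TXr gen i)); rewrite !fE.
- by move: (H _ _ (ahc_TX gen ja jb)); rewrite !fE.
- by move: (H _ _ (ahc_TCl gen i)); rewrite !fE.
- by move: (H _ _ (ahc_TCr gen i)); rewrite !fE.
- by move: (H _ _ (ahc_TC gen ja jb)); rewrite !fE.
- by move: (H _ _ (ahc_XC gen i)); rewrite !fE.
- by move: (H _ _ (ahc_XCcomm gen ij)); rewrite !fE.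
Qed.

Definition hc_gen_widen m (g : hc_gen m) : hc_gen m.+1 :=
  match g with
  | HT i => @HT m.+1 (widen_ord (leq_pred m) i)
  | HX i => HX (widen_ord (leqnSn m) i)
  | HXV i => HXV (widen_ord (leqnSn m) i)
  | HC i => HC (widen_ord (leqnSn m) i)
  end.

Lemma ahc_rel_widen m (A : centralAlgType K) (gen : hc_gen m.+1 -> A) u v :
  ahc_rel (fun g => gen (@hc_gen_widen m g)) u v -> ahc_rel gen u v.
Proof.
have wl i : widen_ord (leqnSn m) (strandl i) =
  strandl (widen_ord (leq_pred m) i : 'I_m.+1.-1) by exact: val_inj.
have wr i : widen_ord (leqnSn m) (strandr i) =
  strandr (widen_ord (leq_pred m) i : 'I_m.+1.-1) by exact: val_inj.
by case=> * /=; rewrite /= ?wl ?wr; constructor; rewrite // -?wl -?wr -val_eqE.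
Qed.

Section AffineHeckeClifford.
Variable n : nat.

Definition ahc_relator (x : free_alg K (hc_gen n)) : Prop :=
  exists u v, ahc_rel (@free_gen K _) u v /\ x = u - v.

Definition AHC : Type := quot_alg ahc_relator.
HB.instance Definition _ := CentralAlgebra.on AHC.

Definition ahc_gen (g : hc_gen n) : AHC := quot_pi ahc_relator (free_gen K g).

Definition ahc_X1 (x : AHC) : Prop :=
  exists i : 'I_n, i = 0%N :> nat /\ x = ahc_gen (HX i) - 1.

Definition HeckeClifford : Type := quot_alg ahc_X1.
HB.instance Definition _ := CentralAlgebra.on HeckeClifford.

Definition hecke_gen (g : hc_gen n) : HeckeClifford := quot_pi ahc_X1 (ahc_gen g).

Definition free_parity (b : bool) (x : free_alg K (hc_gen n)) : Prop :=
  forall w, w \in msupp x -> odd (count (@hc_gen_parity n) w) = b.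

Definition hecke_parity (b : bool) (x : HeckeClifford) : Prop :=
  exists y, free_parity b y /\ x = quot_pi ahc_X1 (quot_pi ahc_relator y).

End AffineHeckeClifford.

Definition hecke_incl m : HeckeClifford m -> HeckeClifford m.+1 :=
  quot_lift (quot_lift (free_lift (fun g => hecke_gen (hc_gen_widen g)))).

Lemma hecke_gen_rel n u v : ahc_rel (@hecke_gen n) u v -> u = v.
Proof.
pose f := quot_pi (@ahc_X1 n) \o quot_pi (@ahc_relator n).
apply: (@ahc_rel_morph_eq n _ _ f (@free_gen K _)) => // {u v} u v uv.
rewrite /f /=; congr quot_pi; apply/quot_piP.
rewrite -[_ - _]mulr1 -[_ - _]mul1r; apply: ideal_gen_in.
by exists u, v.
Qed.

Lemma hecke_X1 n (i : 'I_n) : i = 0%N :> nat -> hecke_gen (HX i) = 1.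
Proof.
move=> i0; rewrite /hecke_gen -(rmorph1 (quot_pi (@ahc_X1 n))); apply/quot_piP.
rewrite -[_ - _]mulr1 -[_ - _]mul1r; apply: ideal_gen_in.
by exists i.
Qed.

Lemma hecke_incl_rmorphism m :
  exists2 f : {rmorphism HeckeClifford m -> HeckeClifford m.+1},
    @hecke_incl m =1 f &
    (forall a, f (scal a) = scal a) /\
    (forall g, f (hecke_gen g) = hecke_gen (hc_gen_widen g)).
Proof.
pose f : {rmorphism _ -> _} := free_lift (fun g => hecke_gen (@hc_gen_widen m g)).
have fg g : f (free_gen K g) = hecke_gen (hc_gen_widen g) by exact: free_lift_gen.
have fs a : f (scal a) = scal a by exact: free_lift_scal.
have f0 s : ahc_relator s -> f s = 0.
  move=> [u [v [uv ->]]]; rewrite rmorphB; apply/eqP; rewrite subr_eq0.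
  by apply/eqP/hecke_gen_rel/ahc_rel_widen; apply: (ahc_rel_morph fs fg uv).
have [f1 f1E] := quot_lift_rmorphism f0.
have {}f1E : quot_lift f = f1 by exact: funext.
have f1pi x : f1 (quot_pi _ x) = f x by rewrite -f1E quot_liftE.
have f10 s : ahc_X1 s -> f1 s = 0.
  move=> [i [i0 ->]]; rewrite rmorphB rmorph1 /ahc_gen f1pi fg /=.
  by rewrite hecke_X1 ?subrr.
have [f2 f2E] := quot_lift_rmorphism f10.
have f2pi x : f2 (quot_pi _ x) = f1 x by rewrite -f2E quot_liftE.
exists f2; first by move=> x; rewrite /hecke_incl -f2E -f1E.
split=> [a|g]; last by rewrite /hecke_gen /ahc_gen f2pi f1pi fg.
by rewrite -[RHS]fs -f1pi -f2pi.
Qed.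

(* H(m) T_m H(m), which is 0 when m = 0 *)
Inductive hecke_HTH m : HeckeClifford m.+1 -> Prop :=
| hecke_HTH0 : hecke_HTH 0
| hecke_HTHD x y : hecke_HTH x -> hecke_HTH y -> hecke_HTH (x + y)
| hecke_HTH_in (i : 'I_m) x y : i.+1 = m ->
    hecke_HTH (hecke_incl x * hecke_gen (@HT m.+1 i) * hecke_incl y).

(* The decomposition of H(m+1) determines a; otherwise the value is junk.      *)
Definition hecke_eps m (h : HeckeClifford m.+1) : HeckeClifford m :=
  xget 0 [set a | exists z b, hecke_HTH z /\
    h = z + hecke_incl a + hecke_gen (HC ord_max) * hecke_incl b]%classic.

(* the identification H(0) = K *)
Definition hecke_val0 (x : HeckeClifford 0) : K :=
  xget 0 [set c | x = scal c]%classic.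

Fixpoint hecke_tau n : HeckeClifford n -> K :=
  match n with
  | 0 => hecke_val0
  | m.+1 => fun h => hecke_tau (hecke_eps h)
  end.

Definition hecke_t n (h : HeckeClifford n) : K :=
  hecke_tau (h * \prod_(i < n) (1 + hecke_gen (HX i))).

End HeckeClifford.

(* Main.v *)
(* Put h_k = C_k X_k and eps = q - q^-1.  The relations of H(n) say exactly    *)
(* that h_0 = C_0 and h_(k+1) = T_k^-1 h_k T_k, so H(n) is presented by the    *)
(* T_i and C_i alone.  Inducing from H(m) gives an H(m+1)-module that is free  *)
(* over H(m); it yields a basis, the projection eps_m : H(m+1) -> H(m) and     *)
(* the non-degeneracy of tau.  The Nakayama automorphism nu of tau sends C_i   *)
(* to h_i and T_i to T_i - eps h_i h_(i+1); the product z of the 1 + X_i       *)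
(* satisfies z nu(x) = x z, so tau(- z) is symmetric.  Finally, the            *)
(* intertwiner T_k Y_k - Y_k T_k, where Y_k = X_k + X_k^-1, shows that the     *)
(* eigenvalues of Y_k are among the residues                                   *)
(*   q(i) = 2 (q^(2i+1) + q^-(2i+1)) / (q + q^-1), i <= k,                     *)
(* and -2 is not one of them exactly by the assumption on q, so z is regular.  *)
From HB Require Import structures.
Require Import Defs.
From mathcomp Require Import all_boot all_order all_algebra.
From mathcomp Require Import boolp classical_sets finmap zify ring.
From mathcomp.multinomials Require Import monalg.
From Stdlib Require Ncring Ncring_tac.

Set Implicit Arguments.
Unset Strict Implicit.
Unset Printing Implicit Defensive.

Import GRing.Theory.
Local Open Scope ring_scope.

(** The form tau is non-degenerate but not a trace: tau(x y) = tau(y nu(x)) for its Nakayama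
    automorphism nu. If z nu(x) = x z for all x, then tau(x y z) = tau(y z nu(x)) = tau(y x z), so
    tau(- z) is a trace, and it is non-degenerate as soon as x z = 0 forces x = 0. The proof does
    this for z, the product of the 1 + X_i.

    Control of tau. Since the T_i and C_i with their relations present H(n) ([hecke_lift]), an
    H(m+1)-module is given by endomorphisms satisfying these relations. The induced module, written
    in coordinates ([ind_hc_system]), makes the C_k^b u_k, with u_k = T_k ... T_(m-1), a basis of
    H(m+1) over H(m) and realizes the projection [eps] as a coefficient. Non-degeneracy
    ([eps_nondeg], [tau_nondeg]) is then a triangular argument on coefficients.

    Nakayama automorphism. The values nu(C_i) = h_i and nu(T_i) = T_i - eps h_i h_(i+1) come from a
    joint induction ([nak_T_top], [nak_C_top_S]), tested on the summands of H(m+1) = H(m) T_(m-1)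
    H(m) + H(m) + C_m H(m). The identity z nu(x) = x z is checked on generators ([prod_one_X_C],
    [prod_one_X_T]).

    Regularity of z. As (1 + X_k)(1 + X_k^-1) = 2 + Y_k, it suffices that -2 is not an eigenvalue of
    Y_k. The intertwiner between Y_k and Y_(k+1) has as square a polynomial in both ([Psi_sq]),
    which lets one list the possible eigenvalues by induction on k ([Y_annul]): they are residues of
    index at most k. Finally 2 + [residue q i] is, up to a unit, 2 (1 + q^(2i)) (1 + q^(2i+2)), and
    q^(2m) = -1 with 1 <= m <= n would make q a primitive 4l-th root of unity with l <= n. *)

Section NcRing.
Variable A : pzRingType.

#[global] Instance pzRing_ops : @Ncring.Ring_ops A 0 1 (fun x y => x + y)
  (fun x y => x * y) (fun x y => x - y) (fun x => - x) eq := {}.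

#[global] Instance pzRing_ncring : @Ncring.Ring A _ _ _ _ _ _ _ pzRing_ops.
Proof.
split; try exact _; first [exact: add0r | exact: addrC | exact: addrA
  | exact: mul1r | exact: mulr1 | exact: mulrA | exact: mulrDl | by [] |
    exact: subrr | by move=> x y z; exact: mulrDr].
Qed.

End NcRing.

Ltac ncring := Ncring_tac.non_commutative_ring.

(** * The relations between the T_i, the C_i and the elements h_k *)

Section HeckeCliffordSystem.
Variables (K : fieldType) (q : K) (A : centralAlgType K).
Local Notation e := (scal (q - q^-1) : A).
Implicit Types (n i j k : nat) (T C : nat -> A) (x y : A).

Record hc_system n T C : Prop := {
  hcTT i : (i.+1 < n)%N -> T i * T i = e * T i + 1;
  hcTT_comm i j : (i.+1 < j)%N -> (j.+1 < n)%N -> T i * T j = T j * T i;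
  hc_braid i : (i.+2 < n)%N -> T i * T i.+1 * T i = T i.+1 * T i * T i.+1;
  hcCC i : (i < n)%N -> C i * C i = 1;
  hcC_anti i j : (i < j)%N -> (j < n)%N -> C i * C j = - (C j * C i);
  hcTC i : (i.+1 < n)%N -> T i * C i = C i.+1 * T i;
  hcTC_comm i j : (i.+1 < n)%N -> (j < n)%N -> j != i -> j != i.+1 ->
    T i * C j = C j * T i
}.

(* [hc_h T C k] is C_k X_k; it is locked so that rewriting does not unfold    *)
(* [hc_h T C k.+1] to a product.  [T j - e] is the inverse of [T j].          *)
Fixpoint hc_h_rec T C k : A :=
  if k is j.+1 then (T j - e) * hc_h_rec T C j * T j else C 0%N.

Definition hc_h T C : nat -> A := locked (hc_h_rec T C).

Lemma hc_h0 T C : hc_h T C 0%N = C 0%N. Proof. by rewrite /hc_h -lock. Qed.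

Lemma hc_hS T C k : hc_h T C k.+1 = (T k - e) * hc_h T C k * T k.
Proof. by rewrite /hc_h -lock. Qed.

Lemma epsC x : x * e = e * x. Proof. by rewrite scalC. Qed.

Lemma epsCA x y : x * (e * y) = e * (x * y). Proof. by rewrite mulrA epsC mulrA. Qed.

Definition anti x y := x * y = - (y * x).

Lemma antiC x y : anti x y -> anti y x.
Proof. by rewrite /anti => ->; rewrite opprK. Qed.

Lemma comm_anti_mul x y z : x * y = y * x -> anti x z -> anti x (y * z).
Proof. by rewrite /anti => H G; rewrite mulrA H -(mulrA y x) G; ncring. Qed.

Lemma anti_mul_comm x y z : anti x y -> x * z = z * x -> anti x (y * z).
Proof. by rewrite /anti => H G; rewrite mulrA H mulNr -(mulrA y x) G mulrA. Qed.

Section Theory.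
Variables (n : nat) (T C : nat -> A) (hc : hc_system n T C).
Local Notation h := (hc_h T C).
Local Notation TV i := (T i - e).

Lemma hTVT i : (i.+1 < n)%N -> TV i * T i = 1.
Proof. by move=> lin; rewrite mulrBl (hcTT hc lin); ncring. Qed.

Lemma hTTV i : (i.+1 < n)%N -> T i * TV i = 1.
Proof. by move=> lin; rewrite mulrBr epsC (hcTT hc lin); ncring. Qed.

Lemma comm_TV x i : x * T i = T i * x -> x * TV i = TV i * x.
Proof. by move=> H; rewrite mulrBr mulrBl H epsC. Qed.

Lemma hTT_comm i j : (i.+1 < n)%N -> (j.+1 < n)%N -> (i.+1 < j)%N || (j.+1 < i)%N ->
  T i * T j = T j * T i.
Proof.
by move=> li lj /orP[] H; [exact: (hcTT_comm hc)|rewrite (hcTT_comm hc H)].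
Qed.

Lemma hCC_anti i j : (i < n)%N -> (j < n)%N -> i != j -> anti (C i) (C j).
Proof.
move=> li lj; case: ltngtP => // ij _; first exact: (hcC_anti hc).
by apply: antiC; exact: (hcC_anti hc).
Qed.

Lemma braid_conj i : (i.+2 < n)%N ->
  TV i.+1 * TV i * T i.+1 = T i * TV i.+1 * TV i.
Proof.
move=> li; have br := hc_braid hc li.
have l1 : TV i.+1 * TV i * (T i * T i.+1) = 1.
  by rewrite mulrA -(mulrA (TV i.+1)) hTVT ?mulr1 ?hTVT //; lia.
have l2 : T i * T i.+1 * (TV i.+1 * TV i) = 1.
  by rewrite mulrA -(mulrA (T i)) hTTV ?mulr1 ?hTTV //; lia.
rewrite -[RHS]mul1r -l1 -[LHS]mulr1 -!mulrA; congr (_ * (_ * _)).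
transitivity (T i.+1); first by rewrite mulr1.
transitivity (T i * T i.+1 * T i * (TV i.+1 * TV i)); last by rewrite !mulrA.
by rewrite br -(mulrA (T i.+1)) -mulrA l2 mulr1.
Qed.

(** The only step that is not plain commutation is T_i against h_(i+2), the conjugate of h_i by T_i
    T_(i+1). There the braid relation turns T_i into T_(i+1), which commutes with h_i, and back. *)
Lemma hTh_comm k i : (k < n)%N -> (i.+1 < n)%N -> i != k -> i.+1 != k ->
  T i * h k = h k * T i.
Proof.
elim/ltn_ind: k i => -[|k] IH i lk li ik ik1.
  by rewrite hc_h0; apply: (hcTC_comm hc); lia.
have [ik2|ik2] : i.+1 = k \/ i.+1 <> k by lia.
  subst k.
  have c1 : T i.+1 * h i = h i * T i.+1 by apply: IH; lia.
  have br := braid_conj lk.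
  have br2 := hc_braid hc lk.
  transitivity (TV i.+1 * TV i * T i.+1 * h i * T i * T i.+1).
    by rewrite !hc_hS !mulrA br.
  transitivity (TV i.+1 * TV i * h i * (T i.+1 * T i * T i.+1)).
    by rewrite -(mulrA _ (T i.+1)) c1 !mulrA.
  by rewrite -br2 !hc_hS !mulrA.
have c1 : T i * h k = h k * T i by apply: IH; lia.
have c2 : T i * T k = T k * T i by apply: hTT_comm; lia.
by rewrite hc_hS !mulrA (comm_TV c2) -(mulrA _ (T i)) c1 -!mulrA c2 !mulrA.
Qed.

Lemma hThS i : (i.+1 < n)%N -> T i * h i.+1 = h i * T i.
Proof. by move=> li; rewrite hc_hS !mulrA hTTV // mul1r. Qed.

Lemma hTh i : (i.+1 < n)%N -> T i * h i = h i.+1 * T i + e * (h i - h i.+1).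
Proof.
move=> li; have E : h i.+1 * TV i = TV i * h i by rewrite hc_hS -mulrA hTTV // mulr1.
have: h i.+1 * T i = TV i * h i + e * h i.+1 by rewrite -E mulrBr epsC subrK.
by move=> ->; ncring.
Qed.

Lemma hTC_r i : (i.+1 < n)%N -> T i * C i.+1 = C i * T i - e * (C i - C i.+1).
Proof.
move=> li; have E : T i * C i * TV i = C i.+1.
  by rewrite (hcTC hc) // -mulrA hTTV // mulr1.
have E2: C i.+1 * T i = T i * C i by rewrite (hcTC hc).
have E3 : TV i * C i.+1 = C i * TV i by rewrite -E !mulrA hTVT // mul1r.
have: T i * C i.+1 = C i * TV i + e * C i.+1 by rewrite -E3 mulrBl subrK.
by move=> ->; rewrite mulrBr epsC; ncring.
Qed.

Lemma h_sq k : (k < n)%N -> h k * h k = 1.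
Proof.
elim: k => [|k IH] lk; first by rewrite hc_h0 (hcCC hc).
transitivity (TV k * h k * (T k * TV k) * h k * T k); first by rewrite hc_hS !mulrA.
by rewrite hTTV // mulr1 -(mulrA (TV k)) IH ?mulr1 ?hTVT //; lia.
Qed.

Lemma comm_conj x k : (k.+1 < n)%N -> x * T k = T k * x -> anti x (h k) ->
  anti x (h k.+1).
Proof.
move=> lk c a; rewrite hc_hS; apply: anti_mul_comm => //; apply: comm_anti_mul => //.
exact: comm_TV.
Qed.

Lemma C_h_anti_gt i j : (i < j)%N -> (j < n)%N -> anti (C j) (h i).
Proof.
elim: i => [|i IH] ij jn; first by rewrite hc_h0; apply: hCC_anti; lia.
apply: comm_conj; [lia| |by apply: IH; lia].
by rewrite (hcTC_comm hc) //; lia.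
Qed.

Lemma C_h_anti i j : (i < n)%N -> (j < n)%N -> i != j -> anti (C j) (h i).
Proof.
move=> li lj; case: ltngtP => // [ij|ji] _; first exact: C_h_anti_gt.
elim: i ji li => [|i IH] // ji li.
have [ji1|ji1] : (j < i)%N \/ i = j by lia.
  by apply: comm_conj; [lia|rewrite (hcTC_comm hc) //; lia|apply: IH; lia].
(* C_i and h_(i+1) are the conjugates by T_i of C_(i+1) and h_i, which anticommute by the case
   already treated. *)
subst j; rewrite /anti.
have E : C i = TV i * C i.+1 * T i by rewrite -mulrA -(hcTC hc) // mulrA hTVT ?mul1r.
have a : anti (C i.+1) (h i) by apply: C_h_anti_gt.
transitivity (TV i * C i.+1 * (T i * TV i) * h i * T i); first by rewrite {1}E hc_hS !mulrA.
rewrite hTTV // mulr1 -(mulrA _ (C _)) a.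
transitivity (- (TV i * h i * (T i * TV i) * C i.+1 * T i)).
  by rewrite hTTV // mulr1; ncring.
by rewrite E hc_hS !mulrA.
Qed.

(** Conjugation by g = T_(i+1) T_i carries the pair (h_i, h_(i+1)) to (h_(i+1), h_(i+2)), so
    everything reduces to h_0 = C_0 and h_1. *)
Lemma h_h_anti_S i : (i.+1 < n)%N -> anti (h i) (h i.+1).
Proof.
elim: i => [|i IH] li.
  have a : anti (C 1%N) (C 0%N) by apply: hCC_anti; lia.
  have := C_h_anti (i := 1%N) (j := 0%N) li; by rewrite hc_h0; apply; lia.
have {}IH : anti (h i) (h i.+1) by apply: IH; lia.
pose g := T i.+1 * T i; pose g' := TV i * TV i.+1.
have gg' : g * g' = 1.
  by rewrite /g /g' !mulrA -(mulrA _ (T i)) hTTV ?mulr1 ?hTTV //; lia.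
have c1 : T i.+1 * h i = h i * T i.+1 by apply: hTh_comm; lia.
have c2 : T i * h i.+2 = h i.+2 * T i by apply: hTh_comm; lia.
have E1 : h i.+1 = g' * h i * g.
  rewrite /g /g' !mulrA -(mulrA _ (h i)) -c1 !mulrA -(mulrA _ (TV i.+1)) hTVT //.
  by rewrite mulr1 hc_hS.
have E2 : h i.+2 = g' * h i.+1 * g.
  rewrite /g /g' !mulrA; transitivity (TV i * h i.+2 * T i); last by rewrite hc_hS !mulrA.
  by rewrite -mulrA -c2 mulrA hTVT ?mul1r //; lia.
clearbody g g'; rewrite /anti E2 {1 4}E1.
transitivity (g' * h i * (g * g') * h i.+1 * g); first by rewrite !mulrA.
rewrite gg' mulr1 -(mulrA g') IH.
transitivity (- (g' * h i.+1 * (g * g') * h i * g)); last by rewrite !mulrA.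
by rewrite gg' mulr1; ncring.
Qed.

Lemma h_h_anti i j : (i < n)%N -> (j < n)%N -> i != j -> anti (h i) (h j).
Proof.
wlog ij : i j / (i < j)%N => [W|].
  move=> li lj; case: ltngtP => // ij _; first by apply: W; lia.
  by apply: antiC; apply: W; lia.
move=> _ + _; elim: j ij => // j IH ij lj.
have [->|ij1] : i = j \/ (i < j)%N by lia.
  exact: h_h_anti_S.
by apply: comm_conj => //; [rewrite hTh_comm //; lia|apply: IH; lia].
Qed.

End Theory.
End HeckeCliffordSystem.

(** * Relations for X_k = C_k h_k and the universal property of H(n) *)

Section Rels.
Variables (K : fieldType) (q : K) (A : centralAlgType K).
Local Notation e := (scal (q - q^-1) : A).
Variables (n : nat) (T C : nat -> A) (hc : hc_system q n T C).
Local Notation h := (hc_h q T C).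
Local Notation TV i := (T i - e).
Local Notation X k := (C k * h k).
Local Notation XV k := (h k * C k).

Lemma anti2_comm (a b c : A) : anti a c -> anti b c -> a * b * c = c * (a * b).
Proof. by rewrite /anti => H G; rewrite -mulrA G mulrN (mulrA a) H; ncring. Qed.

Lemma X_XV k : (k < n)%N -> X k * XV k = 1.
Proof.
by move=> lk; rewrite mulrA -(mulrA (C k)) (h_sq hc) // mulr1 (hcCC hc).
Qed.

Lemma XV_X k : (k < n)%N -> XV k * X k = 1.
Proof.
by move=> lk; rewrite mulrA -(mulrA (h k)) (hcCC hc) // mulr1 (h_sq hc).
Qed.

Lemma X_C_comm i j : (i < n)%N -> (j < n)%N -> i != j -> X i * C j = C j * X i.
Proof.
move=> li lj ij; apply: anti2_comm; first exact: (hCC_anti hc).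
by apply: antiC; apply: (C_h_anti hc).
Qed.

Lemma X_h_comm i j : (i < n)%N -> (j < n)%N -> i != j -> X i * h j = h j * X i.
Proof.
move=> li lj ij; apply: anti2_comm; last exact: (h_h_anti hc).
by apply: (C_h_anti hc) => //; rewrite eq_sym.
Qed.

Lemma X_comm i j : (i < n)%N -> (j < n)%N -> X i * X j = X j * X i.
Proof.
move=> li lj; have [->//|ij] := eqVneq i j.
by rewrite mulrA X_C_comm // -mulrA X_h_comm // mulrA.
Qed.

Lemma TX_comm i j : (i.+1 < n)%N -> (j < n)%N -> j != i -> j != i.+1 ->
  T i * X j = X j * T i.
Proof.
move=> li lj ji ji1; rewrite mulrA (hcTC_comm hc) // -mulrA.
by rewrite (hTh_comm hc) ?mulrA // eq_sym.
Qed.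

Lemma CCX i : (i.+1 < n)%N -> C i * C i.+1 * X i = - (C i.+1 * h i).
Proof.
move=> li; rewrite (hCC_anti hc) //; try lia; rewrite mulNr; congr (- _).
by rewrite mulrA -(mulrA (C i.+1)) (hcCC hc) ?mulr1 //; lia.
Qed.

Lemma CCXS i : (i.+1 < n)%N -> C i * C i.+1 * X i.+1 = C i * h i.+1.
Proof. by move=> li; rewrite mulrA -(mulrA (C i)) (hcCC hc) // mulr1. Qed.

Lemma TX i : (i.+1 < n)%N ->
  T i * X i = X i.+1 * T i - e * (X i.+1 + C i * C i.+1 * X i).
Proof.
move=> li; rewrite CCX // mulrA (hcTC hc) // -mulrA (hTh hc) // mulrDr epsCA.
by ncring.
Qed.

Lemma TXS i : (i.+1 < n)%N ->
  T i * X i.+1 = X i * T i + e * ((1 - C i * C i.+1) * X i.+1).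
Proof.
move=> li; rewrite mulrBl mul1r CCXS // mulrA (hTC_r hc) // mulrBl -(mulrA (C i) (T i)).
by rewrite (hThS hc) //; ncring.
Qed.

(** This is the converse of [TXS]: the relation determines x' from x. It forces the generators X_i
    of H(n) to be C_i h_i in [hecke_CX]. *)
Lemma TXS_inv i (x x' : A) : (i.+1 < n)%N ->
  T i * x' = x * T i + e * ((1 - C i * C i.+1) * x') ->
  C i.+1 * x' = TV i * (C i * x) * T i.
Proof.
move=> li E; rewrite -[LHS]mul1r -(hTVT hc li) -!mulrA; congr (_ * _).
rewrite mulrA (hTC_r hc) // mulrBl -(mulrA (C i)) E mulrDr epsCA mulrBl mul1r.
rewrite mulrBr -(mulrA (C i) (C i.+1)) (mulrA (C i) (C i)) (hcCC hc) ?mul1r; last by lia.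
by rewrite -(mulrA e); ncring.
Qed.

Definition hc_system_gen (g : hc_gen n) : A :=
  match g with
  | HT i => T i
  | HX i => X i
  | HXV i => XV i
  | HC i => C i
  end.

Lemma hc_system_rel u v : ahc_rel q hc_system_gen u v -> u = v.
Proof.
have lt1 (i : 'I_n.-1) : (i.+1 < n)%N by have := ltn_ord i; lia.
have ne (i j : 'I_n) : i != j -> i != j :> nat by rewrite val_eqE.
case=> [i|i j ij|i j ij|i j|i|i|i|i j ij|i a b|i a b|i j ja jb|i a b|i a b
  |i j ja jb|i|i j ij]; rewrite /= ?ij.
- by rewrite expr2 (hcTT hc).
- by apply: (hTT_comm hc).
- by apply: (hc_braid hc); rewrite -ij.
- exact: X_comm.
- exact: X_XV.
- exact: XV_X.
- by rewrite expr2 (hcCC hc).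
- by apply: (hCC_anti hc) => //; apply: ne.
- exact: TX.
- exact: TXS.
- exact: TX_comm.
- exact: (hcTC hc).
- exact: (hTC_r hc).
- exact: (hcTC_comm hc).
- by rewrite mulrA.
- by apply: X_C_comm => //; apply: ne.
Qed.

(** The relations on the T_i and C_i alone imply all the affine ones for C_k h_k, and C_0 h_0 =
    C_0^2 = 1 gives the cyclotomic relation X_1 = 1. *)
Lemma hecke_lift : exists f : {rmorphism HeckeClifford q n -> A},
  (forall a, f (scal a) = scal a) /\
  (forall g, f (hecke_gen q g) = hc_system_gen g).
Proof.
pose f : {rmorphism _ -> _} := free_lift hc_system_gen.
have fg g : f (free_gen K g) = hc_system_gen g by exact: free_lift_gen.
have fs a : f (scal a) = scal a by exact: free_lift_scal.
have f0 s : ahc_relator q s -> f s = 0.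
  move=> [u [v [uv ->]]]. rewrite rmorphB; apply/eqP; rewrite subr_eq0.
  by apply/eqP/hc_system_rel; apply: (ahc_rel_morph fs fg uv).
have [f1 f1E] := quot_lift_rmorphism f0.
have f1pi x : f1 (quot_pi _ x) = f x by rewrite -f1E quot_liftE.
have f10 s : ahc_X1 s -> f1 s = 0.
  move=> [i [i0 ->]]; rewrite rmorphB rmorph1 /ahc_gen f1pi fg /= i0 hc_h0.
  by rewrite (hcCC hc) ?subrr // -i0.
have [f2 f2E] := quot_lift_rmorphism f10.
have f2pi x : f2 (quot_pi _ x) = f1 x by rewrite -f2E quot_liftE.
exists f2; split=> [a|g]; last by rewrite /hecke_gen /ahc_gen f2pi f1pi fg.
by rewrite -[RHS]fs -f1pi -f2pi.
Qed.

(* the image of [T i] under the Nakayama automorphism of tau, see [nak] below *)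
Local Notation N i := (T i - e * (h i * h i.+1)).

Lemma one_X_h i : (i < n)%N -> (1 + X i) * h i = C i * (1 + X i).
Proof.
move=> li; rewrite mulrDl mulrDr mul1r mulr1 -mulrA (h_sq hc) // mulr1.
by rewrite mulrA (hcCC hc) // mul1r addrC.
Qed.

(** This is z nu(T_i) = T_i z for the two factors of z that do not commute with T_i. The corrections
    produced by moving T_i through (1 + X_i)(1 + X_(i+1)) add up to - e (1 + X_i)(1 + X_(i+1)) h_i
    h_(i+1). *)
Lemma TX2 i : (i.+1 < n)%N ->
  (1 + X i) * (1 + X i.+1) * N i = T i * ((1 + X i) * (1 + X i.+1)).
Proof.
move=> li; have li' : (i < n)%N by lia.
have ii1 : i != i.+1 by lia.
have ii2 : i.+1 != i by lia.
have ha := h_h_anti_S hc li; rewrite /anti in ha.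
have ca := hCC_anti hc li' li ii1; rewrite /anti in ca.
have cs := hcCC hc li'; have cs' := hcCC hc li.
have hs := h_sq hc li'; have hs' := h_sq hc li.
have ch := C_h_anti hc li' li ii1; rewrite /anti in ch.
have Xp : X i * (h i * h i.+1) = C i * h i.+1 by rewrite mulrA -(mulrA (C i)) hs mulr1.
have Xp' : X i.+1 * (h i * h i.+1) = - (C i.+1 * h i).
  by rewrite ha mulrN mulrA -(mulrA (C i.+1)) hs' mulr1.
have XC' : X i * C i.+1 = C i.+1 * X i by rewrite X_C_comm.
have XXp : X i * X i.+1 * (h i * h i.+1) = C i * C i.+1.
  rewrite -mulrA Xp' mulrN mulrA XC' -(mulrA (C i.+1)) -(mulrA (C i) (h i)) hs mulr1.
  by rewrite ca.
have XX := X_comm li' li.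
have H1 := TX li; rewrite CCX // in H1.
have H2 := TXS li; rewrite mulrBl mul1r CCXS // in H2.
have Q1 : X i.+1 * (C i * h i.+1) = C i * C i.+1.
  by rewrite mulrA X_C_comm // -(mulrA (C i)) -(mulrA (C i.+1)) hs' mulr1.
have Q2 : C i.+1 * h i * X i.+1 = - (h i * h i.+1).
  by rewrite ch mulNr mulrA -(mulrA (h i)) cs' mulr1.
have H3 : T i * (X i * X i.+1) =
    X i.+1 * X i * T i - e * (C i * C i.+1) - e * (h i * h i.+1).
  have H1' : T i * X i = X i.+1 * T i - e * X i.+1 + e * (C i.+1 * h i).
    by rewrite H1; ncring.
  rewrite (mulrA (T i)) H1' mulrDl mulrBl -(mulrA (X i.+1) (T i)) H2 -(mulrA e (C i.+1 * _)) Q2.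
  by rewrite mulrDr epsCA (mulrBr (X i.+1)) Q1; ncring.
transitivity (T i + T i * X i + T i * X i.+1 + T i * (X i * X i.+1)); last by ncring.
rewrite H1 H2 H3 -XX.
transitivity ((1 + X i) * (1 + X i.+1) * T i - e * (h i * h i.+1 +
    X i * (h i * h i.+1) + X i.+1 * (h i * h i.+1)
    + X i * X i.+1 * (h i * h i.+1))).
  by rewrite mulrBr epsCA; ncring.
by rewrite XXp Xp Xp'; ncring.
Qed.

Lemma hh_mul i : (i.+1 < n)%N -> (h i * h i.+1) * h i = - h i.+1.
Proof.
move=> li; have a := h_h_anti_S hc li; rewrite /anti in a.
by rewrite a mulNr -mulrA (h_sq hc) ?mulr1 //; lia.
Qed.

Lemma mul_hh i : (i.+1 < n)%N -> h i.+1 * (h i * h i.+1) = - h i.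
Proof.
move=> li; have a := h_h_anti_S hc li; rewrite /anti in a.
by rewrite a mulrN mulrA (h_sq hc) ?mul1r //; lia.
Qed.

Lemma N_h i : (i.+1 < n)%N -> N i * h i = h i.+1 * N i.
Proof.
move=> li; rewrite mulrBl mulrBr epsCA (hTh hc) // -(mulrA e) hh_mul // mul_hh //.
by ncring.
Qed.

Lemma T_hh i : (i.+1 < n)%N ->
  T i * (h i * h i.+1) = - (h i * h i.+1 * T i) + e * (h i * h i.+1) - e.
Proof.
move=> li; have a := h_h_anti_S hc li; rewrite /anti in a.
have s2 := h_sq hc li.
rewrite mulrA (hTh hc) // mulrDl -mulrA (hThS hc) // -(mulrA e) mulrBl s2.
by rewrite a; ncring.
Qed.

(** With p = h_i h_(i+1) one has p^2 = -1 and T p + p T = e p - e, so T - e p satisfies the same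
    quadratic relation as T. *)
Lemma N_inv i : (i.+1 < n)%N -> N i * (N i - e) = 1.
Proof.
move=> li; set p := h i * h i.+1; have Tp : T i * p = - (p * T i) + e * p - e := T_hh li.
have pp : p * p = -1.
  rewrite /p mulrA hh_mul // mulNr (h_sq hc) //.
clearbody p.
transitivity (T i * T i - e * (T i * p) - e * T i - e * (p * T i) + e * (e * (p * p)) + e * e * p).
  by rewrite mulrBr epsC mulrBl !mulrBr (epsCA _ (T i)) (epsCA _ (e * p)); ncring.
by rewrite (hcTT hc) // Tp pp; ncring.
Qed.

(* [Y i] is X_i + X_i^-1. *)
Local Notation Y i := (C i * h i + h i * C i).

(** Conjugation by C_i swaps the two terms of Y_i; for j different from i, C_j anticommutes with
    both C_i and h_i. *)
Lemma Y_C i j : (i < n)%N -> (j < n)%N -> Y i * C j = C j * Y i.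
Proof.
move=> li lj; have [->|ij] := eqVneq i j.
  rewrite mulrDl mulrDr -(mulrA (h j)) (hcCC hc) // (mulrA (C j) (C j)) (hcCC hc) //.
  by rewrite mulr1 mul1r mulrA addrC.
have a : anti (h i) (C j) by apply: antiC; apply: (C_h_anti hc).
have b := hCC_anti hc li lj ij.
by rewrite mulrDl mulrDr (anti2_comm a b) (anti2_comm b a).
Qed.

Lemma Y_h i j : (i < n)%N -> (j < n)%N -> Y i * h j = h j * Y i.
Proof.
move=> li lj; have [->|ij] := eqVneq i j.
  rewrite mulrDl mulrDr -(mulrA (C j)) (h_sq hc) // (mulrA (h j) (h j)) (h_sq hc) //.
  by rewrite mulr1 mul1r mulrA addrC.
have a : anti (C i) (h j) by apply: (C_h_anti hc) => //; rewrite eq_sym.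
have b := h_h_anti hc li lj ij.
by rewrite mulrDl mulrDr (anti2_comm a b) (anti2_comm b a).
Qed.

Lemma Y_comm i j : (i < n)%N -> (j < n)%N -> Y i * Y j = Y j * Y i.
Proof.
move=> li lj.
have E1 : Y i * (C j * h j) = C j * h j * Y i.
  by rewrite mulrA Y_C // -(mulrA (C j) (Y i)) Y_h // mulrA.
have E2 : Y i * (h j * C j) = h j * C j * Y i.
  by rewrite mulrA Y_h // -(mulrA (h j) (Y i)) Y_C // mulrA.
by rewrite [LHS]mulrDr [RHS]mulrDl E1 E2.
Qed.

Local Notation R i := (h i * C i + C i.+1 * h i - C i.+1 * h i.+1 - h i.+1 * C i).

Lemma TY i : (i.+1 < n)%N -> T i * Y i = Y i.+1 * T i + e * R i.
Proof.
move=> li; rewrite mulrDr !mulrA (hTh hc) // (hcTC hc) // -(mulrA (C i.+1)).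
rewrite (hTh hc) // mulrDr mulrDl epsCA -(mulrA (h i.+1)) (hcTC hc) //.
by ncring.
Qed.

Lemma TYS i : (i.+1 < n)%N -> T i * Y i.+1 = Y i * T i - e * R i.
Proof.
move=> li; have li' : (i < n)%N by lia.
have a1 : C i.+1 * h i = - (h i * C i.+1) by apply: (C_h_anti hc); lia.
have a2 : C i * h i.+1 = - (h i.+1 * C i) by apply: (C_h_anti hc); lia.
rewrite mulrDr !mulrA (hThS hc) // (hTC_r hc) // mulrBl -(mulrA (C i)) (hThS hc) //.
by rewrite -(mulrA (h i) (T i)) (hTC_r hc) // (mulrBr (h i)) epsCA a1 -(mulrA e) mulrBl a2; ncring.
Qed.

(** * Intertwiners between Y_i and Y_(i+1) *)

Local Notation Psi i := (T i * Y i - Y i * T i).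

Lemma R_comm i j : (i.+1 < n)%N -> (j < n)%N -> Y j * R i = R i * Y j.
Proof.
move=> li lj; have li' : (i < n)%N by lia.
have cC k : (k < n)%N -> GRing.comm (Y j) (C k) by move=> lk; apply: Y_C.
have ch k : (k < n)%N -> GRing.comm (Y j) (h k) by move=> lk; apply: Y_h.
by do ![apply: commrB|apply: commrD]; apply: commrM; auto.
Qed.

Lemma Psi_Y i : (i.+1 < n)%N -> Psi i * Y i = Y i.+1 * Psi i.
Proof.
move=> li; have li' : (i < n)%N by lia.
have := Y_comm li' li; have := R_comm li li'; have := TY li.
move: (Y i) (Y i.+1) (R i) (T i) => y y' r t E cr cy.
have E1 : t * y * y = y' * t * y + e * (r * y) by rewrite E; ncring.
have E2 : y * t * y = y * y' * t + e * (y * r).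
  by rewrite -mulrA E mulrDr epsCA; ncring.
by rewrite mulrBl E1 E2 cr cy; ncring.
Qed.

(** Every word is rewritten with T on the left, using [TY], [TYS] and the quadratic relation; all
    terms still containing T cancel. *)
Lemma Psi_sq_R i : (i.+1 < n)%N -> Psi i * Psi i =
  e * e * (R i * (R i - (Y i - Y i.+1))) - (Y i - Y i.+1) * (Y i - Y i.+1).
Proof.
move=> li; have li' : (i < n)%N by lia.
have := hcTT hc li; have := Y_comm li' li; have := R_comm li li'.
have := R_comm li li; have := TY li; have := TYS li.
move: (Y i) (Y i.+1) (R i) (T i) => y y' r t E2 E1 cr' cr cy E0.
have {E1} E1 : y' * t = t * y - e * r by rewrite E1; ncring.
have {E2} E2 : y * t = t * y' + e * r by rewrite E2; ncring.
have F1 : t * y * t * y = t * t * (y' * y) + e * (t * (r * y)).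
  by rewrite -(mulrA t y) E2 mulrDr epsCA; ncring.
have F2 : t * y * y * t =
    t * t * (y' * y') + e * (t * (r * y')) + e * (t * (r * y)).
  have -> : t * y * y * t = t * (y * t) * y' + e * (t * (y * r)).
    by rewrite -(mulrA _ y t) [in LHS]E2 mulrDr epsCA; ncring.
  by rewrite E2 mulrDr epsCA cr; ncring.
have F3 : y * (t * t) * y = e * (t * (y' * y)) + e * e * (r * y) + y * y.
  by rewrite E0 mulrDr epsCA E2 mulr1; ncring.
have F4 : y * t * y * t = e * (t * (y' * y')) + e * e * (r * y') + y * y'
    + e * (t * (r * y')) + e * e * (r * r).
  have -> : y * t * y * t = y * (t * t) * y' + e * (y * t * r).
    by rewrite -mulrA {2}E2 mulrDr epsCA; ncring.
  by rewrite E0 mulrDr epsCA mulr1 E2 !mulrDl -(mulrA t y' r) cr'; ncring.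
transitivity (t * y * t * y - t * y * y * t - y * (t * t) * y + y * t * y * t).
  by ncring.
by rewrite F1 F2 F3 F4 E0; ncring.
Qed.

Lemma intertwiner_norm (c g c' g' : A) : c * c = 1 -> g * g = 1 -> c' * c' = 1 ->
  g' * g' = 1 -> anti c' c -> anti c' g -> anti g' c -> anti g' g ->
  let r := g * c + c' * g - c' * g' - g' * c in
  r * (r - ((c * g + g * c) - (c' * g' + g' * c'))) =
  (c * g + g * c) * (c' * g' + g' * c') - 4%:R.
Proof.
rewrite /anti => cc gg cc' gg' a1 a2 a3 a4 /=.
have m2 (x y z : A) : x * y = - (y * x) -> z * x * y = - (z * y * x).
  by move=> H; rewrite -mulrA H mulrN mulrA.
have sq (x z : A) : x * x = 1 -> z * x * x = z by move=> H; rewrite -mulrA H mulr1.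
have rules := (a1, a2, a3, a4, fun z => m2 c' c z a1, fun z => m2 c' g z a2,
  fun z => m2 g' c z a3, fun z => m2 g' g z a4, (cc, gg, cc', gg'),
  (fun z => sq c z cc, fun z => sq g z gg, fun z => sq c' z cc',
   fun z => sq g' z gg')).
rewrite !(mulrBr, mulrBl, mulrDr, mulrDl) !mulrA.
have -> : 4%:R = 1 + 1 + 1 + 1 :> A by rewrite (natrD _ 3 1) (natrD _ 2 1).
do !rewrite ?rules ?(mulNr, mulrN, opprK, mul1r, mulr1).
by ncring.
Qed.

Lemma Psi_sq i : (i.+1 < n)%N -> Psi i * Psi i =
  e * e * (Y i * Y i.+1 - 4%:R) - (Y i - Y i.+1) * (Y i - Y i.+1).
Proof.
move=> li; have li' : (i < n)%N by lia.
have ii : i.+1 != i by lia.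
have ii2 : i != i.+1 by lia.
rewrite Psi_sq_R // intertwiner_norm //; try exact: (hcCC hc); try exact: (h_sq hc).
- exact: (hCC_anti hc).
- exact: (C_h_anti hc).
- by apply: antiC; apply: (C_h_anti hc).
- exact: (h_h_anti hc).
Qed.

End Rels.

(** * Invertibility of 1 + X_k *)

Section Residues.
Variables (K : fieldType) (q : K).
Hypotheses (q_neq0 : q != 0) (q_addV : q + q^-1 != 0).

Definition residue (i : nat) : K :=
  2%:R * (q ^+ i.*2.+1 + q ^- i.*2.+1) / (q + q^-1).

Lemma q2_neqN1 : q ^+ 2 + 1 != 0.
Proof.
have -> : q ^+ 2 + 1 = q * (q + q^-1) by field.
by rewrite mulf_neq0.
Qed.

Lemma residue0 : residue 0 = 2%:R.
Proof. by rewrite /residue expr1 -mulrA mulfV // mulr1. Qed.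

(* The roots of [(y - residue i)^2 = eps^2 (residue i * y - 4)] in [y] are     *)
(* [residue (i+1)] and [residue (i-1)], where [residue (-1) = residue 0].      *)
Lemma residue_quadratic i (d := (q - q^-1) * (q - q^-1)) :
  residue i.+1 + residue i.-1 = (2%:R + d) * residue i /\
  residue i.+1 * residue i.-1 = residue i * residue i + 4%:R * d.
Proof.
have := q2_neqN1; rewrite expr2 /d => q2.
case: i => [|i].
  by rewrite !residue0 /residue !exprS expr0; split; field; exact/andP.
have u0 : q ^+ i.*2 != 0 by rewrite expf_neq0.
rewrite /residue /= !doubleS !exprS; move: (q ^+ i.*2) u0 => u u0.
by split; field; exact/and3P.
Qed.

(** This factorization is where the arithmetic condition on q enters. *)
Lemma residue_neqN2 i : 2%:R != 0 :> K ->
  1 + q ^+ i.*2 != 0 -> 1 + q ^+ i.*2.+2 != 0 -> 2%:R + residue i != 0.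
Proof.
move=> char2 h1 h2; have u0 : q ^+ i.*2 != 0 by rewrite expf_neq0.
have := q2_neqN1 => q2.
have q21 : q * q + 1 != 0 by rewrite -expr2.
have -> : 2%:R + residue i =
   2%:R * (1 + q ^+ i.*2) * (1 + q ^+ i.*2.+2) / (q ^+ i.*2.+1 * (q + q^-1)).
  rewrite /residue !exprS; move: (q ^+ i.*2) u0 => u u0; field; exact/and3P.
by rewrite !mulf_neq0 // invr_neq0 // mulf_neq0 // expf_neq0.
Qed.

End Residues.

(** The order d of q divides 4m. The cofactor is odd, since otherwise q^(2m) = 1; hence 4 divides d,
    and l = d/4. *)
Lemma primitive_rootN1 (K : fieldType) (q : K) (m : nat) :
  2%:R != 0 :> K -> (0 < m)%N -> q ^+ m.*2 = -1 ->
  exists2 l, (1 <= l <= m)%N & (4 * l)%N.-primitive_root q.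
Proof.
move=> char2 m0 qm.
have m4 : (0 < 4 * m)%N by lia.
have q4 : q ^+ (4 * m) = 1.
  have -> : (4 * m = m.*2 * 2)%N by lia.
  by rewrite exprM qm sqrrN expr1n.
have [d dq /dvdnP[k dk]] := prim_order_exists m4 q4.
have d0 := prim_order_gt0 dq.
have ok : odd k.
  apply: contraNT char2 => /negbTE ek.
  have k2 : k = (k./2).*2 by have := odd_double_half k; rewrite ek.
  have : q ^+ m.*2 = 1.
    have -> : (m.*2 = d * k./2)%N by lia.
    by rewrite exprM (prim_expr_order dq) expr1n.
  by rewrite qm => /eqP; rewrite eq_sym -subr_eq0 opprK.
have : (4 %| d * k)%N by rewrite mulnC -dk dvdn_mulr.
rewrite Gauss_dvdl; last by rewrite (@coprimeXl 2 2 k) // coprime2n.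
case/dvdnP=> l dl; exists l; last by rewrite mulnC -dl.
by have k0 : (0 < k)%N := odd_gt0 ok; nia.
Qed.

Section Invertibility.
Variables (K : fieldType) (q : K) (A : centralAlgType K).
Variables (n : nat) (T C : nat -> A) (hc : hc_system q n T C).
Hypotheses (char2 : 2%:R != 0 :> K) (q_neq0 : q != 0) (q_addV : q + q^-1 != 0).
Local Notation h := (hc_h q T C).
Local Notation X k := (C k * h k).
Local Notation Y i := (C i * h i + h i * C i).
Local Notation res i := (scal (residue q i) : A).

(** Transfer of spectrum: where y acts by [residue q i], the second relation is a quadratic equation
    for y' whose roots are the residues of index i+1 and i-1. Stating it as annihilation of w by
    products of linear factors avoids eigenvectors and multiplicities. *)
Lemma annul_prod (y y' w : A) k (s : seq nat) : y * y' = y' * y ->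
  all (fun i => i <= k)%N s -> w * \prod_(i <- s) (y - res i) = 0 ->
  w * (scal (q - q^-1) * scal (q - q^-1) * (y * y' - 4%:R)
       - (y - y') * (y - y')) = 0 ->
  exists2 s', all (fun i => i <= k.+1)%N s' & w * \prod_(j <- s') (y' - res j) = 0.
Proof.
move=> cy; have cs z a : GRing.comm z (scal a) by rewrite /GRing.comm scalC.
have cn z m : GRing.comm z m%:R by exact: commr_nat.
have cQ z : GRing.comm z y -> GRing.comm z y' ->
  GRing.comm z (scal (q - q^-1) * scal (q - q^-1) * (y * y' - 4%:R)
       - (y - y') * (y - y')).
  move=> c c'; have cd : GRing.comm z (y - y') by exact: commrB.
  apply: commrB; last exact: commrM.
  apply: commrM; first by apply: commrM; exact: cs.
  by apply: commrB; [exact: commrM|exact: cn].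
have cr z j : GRing.comm y z -> GRing.comm (y - res j) z.
  by move=> c; apply/commr_sym/commrB; [exact/commr_sym|exact: cs].
elim: s w => [|i s IH] w /=.
  by move=> _ H _; exists [::] => //; move: H; rewrite !big_nil.
case/andP=> ik sk; rewrite big_cons mulrA => w0 wQ.
(* Absorbing one factor into w leaves a shorter list. The product found for it makes v below satisfy
   v y = r v, with r the residue of index i. *)
have [|s1 s1k s10] := IH (w * (y - res i)) sk w0.
  by rewrite -mulrA cQ; [rewrite mulrA wQ mul0r|exact: cr|exact: cr].
have cp z : GRing.comm z y' -> GRing.comm z (\prod_(j <- s1) (y' - res j)).
  by move=> c; apply: commr_prod => j _; apply: commrB; [exact: c|exact: cs].
pose v := w * \prod_(j <- s1) (y' - res j).
have vy : v * y = scal (residue q i) * v.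
  apply/eqP; rewrite -subr_eq0 scalC -mulrBr /v -mulrA -(cp (y - res i)).
    by rewrite mulrA s10.
  exact: cr.
have vQ : v * (scal (q - q^-1) * scal (q - q^-1) * (y * y' - 4%:R)
       - (y - y') * (y - y')) = 0.
  have [cPy cPy'] : GRing.comm (\prod_(j <- s1) (y' - res j)) y /\
      GRing.comm (\prod_(j <- s1) (y' - res j)) y'.
    by split; apply/commr_sym/cp.
  by rewrite /v -mulrA (cQ _ cPy cPy') mulrA wQ mul0r.
(* The two extra factors are the roots in y' of the quadratic relation evaluated on v. *)
exists (s1 ++ [:: i.+1; i.-1]).
  by rewrite all_cat s1k /=; lia.
rewrite big_cat /= mulrA -/v !big_cons big_nil mulr1.
have [] := residue_quadratic q_neq0 q_addV i.
clearbody v; move: (residue q i.+1) (residue q i.-1) (residue q i) vy => a b r vy sm pr.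
have -> : (y' - scal a) * (y' - scal b) =
   y' * y' - scal (a + b) * y' + scal (a * b).
  rewrite rmorphD rmorphM mulrBr !mulrBl -(scalC _ y'); ncring.
rewrite sm pr -[RHS]oppr0 -vQ.
have Q1 : v * (y * y') = scal r * (v * y') by rewrite mulrA vy mulrA.
have Q2 : v * (y * y) = scal r * (scal r * v) by rewrite mulrA vy -mulrA vy.
have Q3 : v * (y' * y) = scal r * (v * y') by rewrite -cy.
have -> : v * (scal (q - q^-1) * scal (q - q^-1) * (y * y' - 4%:R)
       - (y - y') * (y - y')) = scal (q - q^-1) * scal (q - q^-1) *
     (v * (y * y') - v * 4%:R) - (v * (y * y) - v * (y * y') - v * (y' * y)
     + v * (y' * y')).
  by rewrite mulrBr -!(mulrA (scal _)) !epsCA; move: 4%:R => f; ncring.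
rewrite Q1 Q2 Q3 mulrDr mulrBr (mulrA v (scal _)) -!(scalC _ v) -(mulrA (scal _)).
move: (q - q^-1) => d.
rewrite (natrD K 3 1) (natrD K 2 1) !(rmorphD, rmorphM) !rmorph1.
have -> : 4%:R = 1 + 1 + 1 + 1 :> A by rewrite (natrD _ 3 1) (natrD _ 2 1).
by ncring.
Qed.

Lemma Y_annul k : (k < n)%N ->
  exists2 s : seq nat, all (fun i => i <= k)%N s & \prod_(i <- s) (Y k - res i) = 0.
Proof.
elim: k => [|k IH] lk.
  exists [:: 0%N] => //.
  by rewrite big_seq1 hc_h0 (hcCC hc) // residue0 // rmorph_nat (natrD _ 1 1) subrr.
have lk' : (k < n)%N by lia.
have [s sk s0] := IH lk'.
pose psi := T k * Y k - Y k * T k.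
have psiY : psi * Y k = Y k.+1 * psi := Psi_Y hc lk.
have psi2 := Psi_sq hc lk; rewrite -/psi in psi2; clearbody psi.
have H : \prod_(i <- s) (Y k.+1 - res i) * psi = psi * \prod_(i <- s) (Y k - res i).
  elim: s {s0 sk} => [|i s IHs]; first by rewrite !big_nil mul1r mulr1.
  rewrite !big_cons mulrA -(mulrA (Y _ - _)) IHs mulrA mulrBl mulrBr psiY.
  by rewrite scalC.
pose w := \prod_(i <- s) (Y k.+1 - res i).
(* The intertwining relation gives w psi = psi times the vanishing product in Y_k, so w psi^2 = 0,
   and [Psi_sq] rewrites psi^2 as the polynomial required here. *)
have [||s' s'k s'0] := @annul_prod (Y k) (Y k.+1) w k s (Y_comm hc lk' lk) sk.
- by rewrite s0 mulr0.
- by rewrite -psi2 mulrA H s0 mulr0 mul0r.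
by exists (s ++ s'); [rewrite all_cat s'k andbT; apply: sub_all sk => i; lia
  | rewrite big_cat].
Qed.

(** Multiplying by 1 + X_k^-1 gives x Y_k = -2 x, so the annihilating product of Y_k acts on x as a
    scalar, which is non-zero because no residue involved equals -2. *)
Lemma mulr_one_X_inj k (x : A) : (k < n)%N ->
  (forall i, (i <= k)%N -> 1 + q ^+ i.+1.*2 != 0) -> x * (1 + X k) = 0 -> x = 0.
Proof.
move=> lk qk x0; have [s /allP sk s0] := Y_annul lk.
have xY : x * (Y k + 2%:R) = 0.
  have -> : Y k + 2%:R = (1 + X k) * (1 + h k * C k).
    rewrite mulrDr mulr1 mulrDl mul1r (X_XV hc) // -[2%:R]/(1 + 1) //.
    by ncring.
  by rewrite mulrA x0 mul0r.
have {}xY : x * Y k = scal (- 2%:R) * x.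
  move: xY; rewrite mulrDr (commr_nat x 2) => /eqP.
  by rewrite addr_eq0 rmorphN rmorph_nat mulNr => /eqP.
have xs r : x * \prod_(i <- r) (Y k - res i) =
    scal (\prod_(i <- r) (- (2%:R + residue q i))) * x.
  elim: r => [|i r IH]; first by rewrite !big_nil rmorph1 mul1r mulr1.
  rewrite !big_cons mulrA mulrBr xY -scalC -mulrBl -rmorphB -mulrA IH.
  by rewrite mulrA -rmorphM (opprD 2%:R).
have := xs s; rewrite s0 mulr0 => /esym x1.
have p0 : \prod_(i <- s) (- (2%:R + residue q i)) != 0.
  rewrite prodf_seq_neq0; apply/allP => i /sk ik /=; rewrite oppr_eq0.
  apply: residue_neqN2 => //; last by rewrite -doubleS; apply: qk.
  (* For i = 0 the first factor is 1 + q^0 = 2. *)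
  case: i ik => [|i] ik; first by rewrite expr0 -[_ + _]/(2%:R).
  by apply: qk; lia.
by rewrite -[x]mul1r -(rmorph1 scal) -(mulVf p0) rmorphM -mulrA x1 mulr0.
Qed.

End Invertibility.

(** * The module induced from H(m) to H(m+1) *)

Section RightEndomorphisms.
Variables (K : fieldType) (A : centralAlgType K) (I : finType).
Local Notation V := {ffun I -> A}.

Definition rscale (v : V) (a : A) : V := [ffun p => v p * a].

Definition right_linear (f : V -> V) : Prop :=
  (forall u v, f (u + v) = f u + f v) /\ (forall v a, f (rscale v a) = rscale (f v) a).

(** Endomorphisms of a free right A-module, made into a K-algebra so that the universal property of
    H(m+1) can map into them. *)
Record rend : Type := REnd { rend_fun :> V -> V; rend_linear : right_linear rend_fun }.

HB.instance Definition _ := gen_eqMixin rend.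
HB.instance Definition _ := gen_choiceMixin rend.

Lemma rendP (f g : rend) : (forall v, f v = g v) -> f = g.
Proof.
case: f g => [f Hf] [g Hg] /= /funext fg; subst g; congr REnd.
exact: Prop_irrelevance.
Qed.

Lemma rend_add_linear (f g : rend) : right_linear (fun v => f v + g v).
Proof.
case: f g => [f [fD fZ]] [g [gD gZ]]; split=> [u v|v a] /=.
  by rewrite fD gD addrACA.
by rewrite fZ gZ; apply/ffunP => p; rewrite !ffunE mulrDl.
Qed.

Lemma rend_opp_linear (f : rend) : right_linear (fun v => - f v).
Proof.
case: f => [f [fD fZ]]; split=> [u v|v a] /=; first by rewrite fD opprD.
by rewrite fZ; apply/ffunP => p; rewrite !ffunE mulNr.
Qed.

Lemma rend_zero_linear : right_linear (fun v => 0).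
Proof.
split=> [u v|v a]; first by rewrite addr0.
by apply/ffunP => p; rewrite !ffunE mul0r.
Qed.

Lemma rend_one_linear : right_linear id. Proof. by []. Qed.

Lemma rend_mul_linear (f g : rend) : right_linear (f \o g).
Proof.
case: f g => [f [fD fZ]] [g [gD gZ]].
by split=> [u v|v a] /=; rewrite ?gD ?fD ?gZ ?fZ.
Qed.

Lemma rend_scal_linear (a : K) : right_linear (fun v => [ffun p => scal a * v p]).
Proof.
split=> [u v|v b]; apply/ffunP => p; rewrite !ffunE; first by rewrite mulrDr.
by rewrite mulrA.
Qed.

Definition rend_add f g := REnd (rend_add_linear f g).
Definition rend_opp f := REnd (rend_opp_linear f).
Definition rend_zero := REnd rend_zero_linear.
Definition rend_one := REnd rend_one_linear.
Definition rend_mul f g := REnd (rend_mul_linear f g).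
Definition rend_scal a := REnd (rend_scal_linear a).

Fact rend_addA : associative rend_add.
Proof. by move=> f g h; apply: rendP => v /=; rewrite addrA. Qed.
Fact rend_addC : commutative rend_add.
Proof. by move=> f g; apply: rendP => v /=; rewrite addrC. Qed.
Fact rend_add0 : left_id rend_zero rend_add.
Proof. by move=> f; apply: rendP => v /=; rewrite add0r. Qed.
Fact rend_addN : left_inverse rend_zero rend_opp rend_add.
Proof. by move=> f; apply: rendP => v /=; rewrite addNr. Qed.

HB.instance Definition _ := GRing.isZmodule.Build rend
  rend_addA rend_addC rend_add0 rend_addN.

Fact rend_mulA : associative rend_mul.
Proof. by move=> f g h; apply: rendP. Qed.
Fact rend_mul1l : left_id rend_one rend_mul.
Proof. by move=> f; apply: rendP. Qed.
Fact rend_mul1r : right_id rend_one rend_mul.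
Proof. by move=> f; apply: rendP. Qed.
Fact rend_mulDl : left_distributive rend_mul +%R.
Proof. by move=> f g h; apply: rendP. Qed.
Fact rend_mulDr : right_distributive rend_mul +%R.
Proof. by move=> f g h; apply: rendP => v /=; case: f => f [fD fZ] /=; rewrite fD. Qed.

HB.instance Definition _ := GRing.Zmodule_isPzRing.Build rend
  rend_mulA rend_mul1l rend_mul1r rend_mulDl rend_mulDr.

Fact rend_scal_additive : {morph rend_scal : a b / a - b}.
Proof.
move=> a b; apply: rendP => v; apply/ffunP => p /=.
by rewrite !ffunE rmorphB mulrBl.
Qed.

Fact rend_scal_monoid : monoid_morphism rend_scal.
Proof.
split=> [|a b]; apply: rendP => v; apply/ffunP => p /=; rewrite !ffunE.
  by rewrite rmorph1 mul1r.
by rewrite rmorphM mulrA.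
Qed.

HB.instance Definition _ :=
  GRing.isZmodMorphism.Build K rend rend_scal rend_scal_additive.
HB.instance Definition _ :=
  GRing.isMonoidMorphism.Build K rend rend_scal rend_scal_monoid.

Fact rend_scalC (a : K) (f : rend) : rend_scal a * f = f * rend_scal a.
Proof.
(* By centrality, left multiplication by a scalar is also right scaling, with which f commutes. *)
apply: rendP => v; rewrite /= [RHS](_ : _ = f (rscale v (scal a))); last first.
  by congr (rend_fun f _); apply/ffunP => p; rewrite !ffunE scalC.
by case: f => f [fD fZ] /=; rewrite fZ; apply/ffunP => p; rewrite !ffunE scalC.
Qed.

HB.instance Definition _ := isCentralAlgebra.Build K rend rend_scalC.

Lemma rendD (f g : rend) v : (f + g) v = f v + g v. Proof. by []. Qed.
Lemma rendN (f : rend) v : (- f) v = - f v. Proof. by []. Qed.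
Lemma rendM (f g : rend) v : (f * g) v = f (g v). Proof. by []. Qed.
Lemma rend1 v : (1 : rend) v = v. Proof. by []. Qed.
End RightEndomorphisms.

(** * The action of the T_i and C_j on the induced module *)

Section Model.
Variables (K : fieldType) (q : K) (A : centralAlgType K) (m : nat).
Variables (T C : nat -> A) (hc : hc_system q m T C).
Local Notation e := (scal (q - q^-1) : A).
Local Notation V := {ffun 'I_m.+1 * bool -> A}.

Definition coord (v : V) (k : nat) (b : bool) : A := v (inord k, b).

Lemma coordP (u v : V) : (forall k b, (k <= m)%N -> coord u k b = coord v k b) -> u = v.
Proof.
move=> uv; apply/ffunP => -[k b]; have := uv k b (leq_ord k).
by rewrite /coord inord_val.
Qed.

Definition vec_of (f : nat -> bool -> A) : V := [ffun p => f (val p.1) p.2].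

Lemma coord_vec_of f k b : (k <= m)%N -> coord (vec_of f) k b = f k b.
Proof. by move=> km; rewrite /coord ffunE /= inordK. Qed.

Lemma coordD u v k b : coord (u + v) k b = coord u k b + coord v k b.
Proof. by rewrite /coord ffunE. Qed.

Lemma coordN u k b : coord (- u) k b = - coord u k b.
Proof. by rewrite /coord ffunE. Qed.

Lemma coord_rscale v a k b : coord (rscale v a) k b = coord v k b * a.
Proof. by rewrite /coord ffunE. Qed.

(* The induced module H(m+1) = \sum_k u_k H(m) + C_k u_k H(m), where           *)
(* u_k = T_k ... T_(m-1); [coord v k b] is the coefficient of C_k^b u_k in v.  *)
Definition modT i (v : V) : V := vec_of (fun k b =>
  if (i.+1 < k)%N then T i * coord v k b
  else if (k < i)%N then T i.-1 * coord v k b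
  else if k == i then
    coord v i.+1 b + (if b then 0 else e * coord v i false + e * C i * coord v i true)
  else
    coord v i b + (if b then e * coord v i.+1 true else - (e * C i * coord v i.+1 true))).

Definition modC j (v : V) : V := vec_of (fun k b =>
  if (j < k)%N then (-1) ^+ b * C j * coord v k b
  else if (k < j)%N then (-1) ^+ b * C j.-1 * coord v k b
  else coord v k (~~ b)).

Lemma modT_linear i : right_linear (modT i).
Proof.
split=> [u v|v a]; apply: coordP => k b km; rewrite ?coordD ?coord_rscale.
  rewrite !coord_vec_of // !coordD.
  by case: ifP => _; [|case: ifP => _; [|case: ifP => _; case: b]]; ncring.
rewrite !coord_vec_of // !coord_rscale.
by case: ifP => _; [|case: ifP => _; [|case: ifP => _; case: b]]; ncring.
Qed.

Lemma modC_linear j : right_linear (modC j).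
Proof.
split=> [u v|v a]; apply: coordP => k b km; rewrite ?coordD ?coord_rscale.
  rewrite !coord_vec_of // !coordD.
  by case: ifP => _; [|case: ifP => _]; ncring.
rewrite !coord_vec_of // !coord_rscale.
by case: ifP => _; [|case: ifP => _]; ncring.
Qed.

Definition indT i : rend A _ := REnd (modT_linear i).
Definition indC j : rend A _ := REnd (modC_linear j).

Lemma indE (f g : rend A ('I_m.+1 * bool)%type) :
  (forall v k b, (k <= m)%N -> coord (f v) k b = coord (g v) k b) -> f = g.
Proof. by move=> fg; apply: rendP => v; apply: coordP => k b; apply: fg. Qed.

Lemma coord_indT i v k b : (k <= m)%N -> coord (indT i v) k b =
  if (i.+1 < k)%N then T i * coord v k b
  else if (k < i)%N then T i.-1 * coord v k b
  else if k == i then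
    coord v i.+1 b + (if b then 0 else e * coord v i false + e * C i * coord v i true)
  else
    coord v i b + (if b then e * coord v i.+1 true else - (e * C i * coord v i.+1 true)).
Proof. exact: coord_vec_of. Qed.

Lemma coord_indC j v k b : (k <= m)%N -> coord (indC j v) k b =
  if (j < k)%N then (-1) ^+ b * C j * coord v k b
  else if (k < j)%N then (-1) ^+ b * C j.-1 * coord v k b
  else coord v k (~~ b).
Proof. exact: coord_vec_of. Qed.

Lemma coord_scal (a : K) v k b : coord ((scal a : rend A _) v) k b = scal a * coord v k b.
Proof. by rewrite /coord /= ffunE. Qed.

Ltac split_if :=
  repeat match goal with |- context [if ?c then _ else _] =>
    first [ rewrite (_ : c = true); [|by [|lia]]
          | rewrite (_ : c = false); [|by [|lia]]
          | let H := fresh "H" in case H : c ] end.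

Lemma T_eCA i x : T i * (e * x) = e * (T i * x). Proof. exact: epsCA. Qed.
Lemma C_eCA i x : C i * (e * x) = e * (C i * x). Proof. exact: epsCA. Qed.

Lemma actTT i x : (i.+1 < m)%N -> T i * (T i * x) = e * (T i * x) + x.
Proof. by move=> im; rewrite mulrA (hcTT hc) // mulrDl mul1r mulrA. Qed.

Lemma actTT_comm i j x : (i.+1 < j)%N -> (j.+1 < m)%N ->
  T i * (T j * x) = T j * (T i * x).
Proof. by move=> ij jm; rewrite mulrA (hcTT_comm hc) // mulrA. Qed.

Lemma act_braid i x : (i.+2 < m)%N ->
  T i * (T i.+1 * (T i * x)) = T i.+1 * (T i * (T i.+1 * x)).
Proof. by move=> im; rewrite !mulrA (hc_braid hc). Qed.

Lemma actCC i x : (i < m)%N -> C i * (C i * x) = x.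
Proof. by move=> im; rewrite mulrA (hcCC hc) // mul1r. Qed.

Lemma actC_anti i j x : (i < m)%N -> (j < m)%N -> i != j ->
  C i * (C j * x) = - (C j * (C i * x)).
Proof. by move=> im jm ij; rewrite mulrA (hCC_anti hc) // mulNr mulrA. Qed.

Lemma actTC i x : (i.+1 < m)%N -> T i * (C i * x) = C i.+1 * (T i * x).
Proof. by move=> im; rewrite mulrA (hcTC hc) // mulrA. Qed.

Lemma actTC_r i x : (i.+1 < m)%N ->
  T i * (C i.+1 * x) = C i * (T i * x) - e * (C i * x - C i.+1 * x).
Proof. by move=> im; rewrite mulrA (hTC_r hc) //; ncring. Qed.

Lemma actTC_comm i j x : (i.+1 < m)%N -> (j < m)%N -> j != i -> j != i.+1 ->
  T i * (C j * x) = C j * (T i * x).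
Proof. by move=> im jm ji ji1; rewrite mulrA (hcTC_comm hc) // mulrA. Qed.

Lemma act_braid_pred i x : (0 < i)%N -> (i.+1 < m)%N ->
  T i.-1 * (T i * (T i.-1 * x)) = T i * (T i.-1 * (T i * x)).
Proof. by case: i => // i _; exact: act_braid. Qed.

Lemma actTC_pred i x : (0 < i)%N -> (i < m)%N ->
  T i.-1 * (C i.-1 * x) = C i * (T i.-1 * x).
Proof. by case: i => // i _; exact: actTC. Qed.

Ltac norm := rewrite ?(expr0, expr1);
  repeat progress (rewrite -?mulrA ?(mulrDr, mulrDl, mulrBr, mulrBl, mulrN, mulNr,
     mul1r, mulr0, mul0r, addr0, opprK, oppr0, T_eCA, C_eCA)).

(** When the inequalities of a case pin the position k to i or i+1, it is substituted so that
    coordinates match syntactically. *)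
Ltac locate i :=
  try match goal with km : is_true (leq ?k m) |- _ =>
    is_var k; first [ constr_eq k i
      | have ?: k = i by [lia]; subst k | have ?: k = i.+1 by [lia]; subst k ] end.

Lemma ind_TT i : (i.+1 < m.+1)%N -> indT i * indT i = scal (q - q^-1) * indT i + 1.
Proof.
move=> im; apply: indE => v k b km; rewrite rendD !rendM rend1 coordD coord_scal.
rewrite !coord_indT; try lia.
by case: b; split_if; locate i; norm; try (by ncring); apply: actTT; lia.
Qed.

Lemma ind_TT_comm i j : (i.+1 < j)%N -> (j.+1 < m.+1)%N ->
  indT i * indT j = indT j * indT i.
Proof.
move=> ij im; apply: indE => v k b km; rewrite !rendM.
rewrite !coord_indT; try lia.
case: b; split_if; locate i; locate j; norm; try (by ncring);
  first [by apply: actTT_comm; lia | by rewrite actTC_comm; try lia; ncring].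
Qed.

Lemma ind_braid i : (i.+2 < m.+1)%N ->
  indT i * indT i.+1 * indT i = indT i.+1 * indT i * indT i.+1.
Proof.
move=> im; apply: indE => v k b km; rewrite !rendM.
rewrite !coord_indT; try lia.
case: b; split_if; locate i; locate (i.+1); norm; try (by ncring);
  try (by rewrite /=; first [apply: act_braid; lia | apply: act_braid_pred; lia]);
  have im' : (i.+1 < m)%N by [lia];
  have R := (fun x => actTC x im', fun x => actTC_r x im', fun x => actTT x im');
  by rewrite /=; repeat progress (rewrite ?R; norm); ncring.
Qed.

Lemma ind_CC i : (i < m.+1)%N -> indC i * indC i = 1.
Proof.
move=> im; apply: indE => v k b km; rewrite !rendM rend1.
rewrite !coord_indC; try lia.
case: b; split_if; locate i; norm; first [by ncring | by apply: actCC; lia].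
Qed.

Lemma ind_C_anti i j : (i < j)%N -> (j < m.+1)%N ->
  indC i * indC j = - (indC j * indC i).
Proof.
move=> ij im; apply: indE => v k b km; rewrite rendN !rendM coordN.
rewrite !coord_indC; try lia.
case: b; split_if; locate i; locate j; norm; first [by ncring | by apply: actC_anti; lia].
Qed.

Lemma ind_TC i : (i.+1 < m.+1)%N -> indT i * indC i = indC i.+1 * indT i.
Proof.
move=> im; apply: indE => v k b km; rewrite !rendM.
rewrite !(coord_indT, coord_indC); try lia.
case: b; split_if; locate i;  norm; try (by ncring);
  try (by rewrite actTC //; lia);
  try (by rewrite /= actCC; [ncring|lia]);
  by rewrite /= actTC_pred //; lia.
Qed.

Lemma ind_TC_comm i j : (i.+1 < m.+1)%N -> (j < m.+1)%N -> j != i -> j != i.+1 ->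
  indT i * indC j = indC j * indT i.
Proof.
move=> im jm ji ji1; apply: indE => v k b km; rewrite !rendM.
rewrite !(coord_indT, coord_indC); try lia.
case: b; split_if; locate i; locate j; norm; try (by ncring);
  first [by rewrite actTC_comm //; lia | by rewrite (actC_anti (i := i)); try lia; ncring].
Qed.

(** The induced module exists without any prior knowledge of the size of H(m+1); all independence
    statements about H(m+1) rest on it. *)
Lemma ind_hc_system : hc_system q m.+1 indT indC.
Proof.
split.
- exact: ind_TT.
- exact: ind_TT_comm.
- exact: ind_braid.
- exact: ind_CC.
- exact: ind_C_anti.
- exact: ind_TC.
- exact: ind_TC_comm.
Qed.

End Model.

Lemma free_lift_unique (K : fieldType) (G : choiceType) (A : centralAlgType K)
    (f : {rmorphism free_alg K G -> A}) :
  (forall c, f (scal c) = scal c) -> forall y, f y = free_lift (f \o @free_gen K G) y.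
Proof.
move=> fs y.
have fw c (w : {fmonom G}) :
    f << c *g w >> = scal c * \prod_(g <- (w : seq _)) f (free_gen K g).
  case: w => w /=; elim: w c => [|g w IH] c.
    rewrite big_nil mulr1 -fs; congr (f << _ *g _ >>).
    by apply: val_inj; rewrite /= fm1.
  have -> : << c *g FMonom (g :: w) >> = free_gen K g * << c *g FMonom w >>.
    rewrite malgM_def fgmulUU mul1r; congr << _ *g _ >>.
    by apply: val_inj; rewrite /= fmM fmU.
  by rewrite rmorphM IH big_cons mulrA -scalC -mulrA.
by rewrite [in LHS](monalgE y) raddf_sum; apply: eq_bigr => w _; exact: fw.
Qed.

(** * The T_i and C_i generate H(n) *)

Section Generation.
Variables (K : fieldType) (q : K).
Local Notation H := (HeckeClifford q).
Local Notation e := (scal (q - q^-1)).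

(** Indexing by [nat], with value 0 out of range, avoids ordinals whose type changes with n. *)
Definition hecke_T n i : H n := oapp (fun j => hecke_gen q (HT j)) 0 (insub i).
Definition hecke_C n i : H n := oapp (fun j => hecke_gen q (HC j)) 0 (insub i).
Definition hecke_h n := hc_h q (@hecke_T n) (@hecke_C n).

Lemma hecke_TE n (j : 'I_n.-1) : hecke_gen q (HT j) = hecke_T n j.
Proof. by rewrite /hecke_T insubT //= => p; congr (hecke_gen _ (HT _)); apply: val_inj. Qed.

Lemma hecke_CE n (j : 'I_n) : hecke_gen q (HC j) = hecke_C n j.
Proof. by rewrite /hecke_C insubT //= => p; congr (hecke_gen _ (HC _)); apply: val_inj. Qed.

Lemma hecke_system n : hc_system q n (@hecke_T n) (@hecke_C n).
Proof.
have toT i : (i.+1 < n)%N -> exists2 j : 'I_n.-1, i = j & hecke_T n i = hecke_gen q (HT j).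
  move=> li; have li' : (i < n.-1)%N by lia.
  by exists (Ordinal li'); rewrite // hecke_TE.
have toC i : (i < n)%N -> exists2 j : 'I_n, i = j & hecke_C n i = hecke_gen q (HC j).
  by move=> li; exists (Ordinal li); rewrite // hecke_CE.
split.
- move=> i /toT[j _ ->]; rewrite -expr2; exact: (hecke_gen_rel (ahc_TT _ _ j)).
- move=> i k ik kn; have /toT[i' ei ->] : (i.+1 < n)%N by lia.
  have /toT[k' ek ->] := kn; apply: hecke_gen_rel; apply: ahc_Tcomm.
  by rewrite -ei -ek ik.
- move=> i lin; have /toT[i' ei ->] : (i.+1 < n)%N by lia.
  have /toT[k' ek ->] := lin; apply: hecke_gen_rel; apply: ahc_braid.
  by rewrite -ei -ek.
- move=> i /toC[j _ ->]; rewrite -expr2; exact: (hecke_gen_rel (ahc_CC _ _ j)).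
- move=> i k ik kn; have /toC[i' ei ->] : (i < n)%N by lia.
  have /toC[k' ek ->] := kn; apply: hecke_gen_rel; apply: ahc_Canti.
  by rewrite -val_eqE /= -ei -ek; lia.
- move=> i li; have /toT[j ej ->] := li.
  rewrite (_ : hecke_C n i = hecke_gen q (HC (strandl j))); last by rewrite hecke_CE /= -ej.
  rewrite (_ : hecke_C n i.+1 = hecke_gen q (HC (strandr j))); last by rewrite hecke_CE /= -ej.
  exact: (hecke_gen_rel (ahc_TCl _ _ j)).
- move=> i k /toT[j ej ->] /toC[k' ek ->] ki ki1.
  by apply: hecke_gen_rel; apply: ahc_TC; rewrite -val_eqE /= -ej -ek.
Qed.

(** Starting from X_1 = 1, the relation for T_i X_(i+1) yields for C_i X_i the recursion that
    defines h_i. *)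
Lemma hecke_CX n i (li : (i < n)%N) :
  hecke_C n i * hecke_gen q (HX (Ordinal li)) = hecke_h n i.
Proof.
elim: i li => [|i IH] li.
  by rewrite hecke_X1 // mulr1 /hecke_h hc_h0.
have li' : (i < n)%N by lia.
have lj : (i < n.-1)%N by lia.
pose j := Ordinal lj.
have := hecke_gen_rel (ahc_TXr q (@hecke_gen K q n) j).
rewrite hecke_TE !hecke_CE /= (_ : strandl j = Ordinal li'); last exact: val_inj.
rewrite (_ : strandr j = Ordinal li); last exact: val_inj.
set X' := hecke_gen _ (HX (Ordinal li)) => E.
rewrite (TXS_inv (hecke_system n) li E) (IH li').
by rewrite /hecke_h hc_hS.
Qed.

Lemma hecke_X n (i : 'I_n) : hecke_gen q (HX i) = hecke_C n i * hecke_h n i.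
Proof.
case: i => i li /=; rewrite -(hecke_CX li) mulrA (hcCC (hecke_system n)) //.
by rewrite mul1r.
Qed.

Lemma hecke_XV n (i : 'I_n) : hecke_gen q (HXV i) = hecke_h n i * hecke_C n i.
Proof.
have E := hecke_gen_rel (ahc_XVX q (@hecke_gen K q n) i).
have XX : hecke_gen q (HX i) * (hecke_h n i * hecke_C n i) = 1.
  by rewrite hecke_X; apply: (X_XV (hecke_system n)).
by rewrite -[LHS]mulr1 -XX mulrA E mul1r.
Qed.

Lemma hecke_h_mull n (P : H n -> Prop) :
  (forall x y, P x -> P y -> P (x + y)) ->
  (forall a x, P x -> P (scal a * x)) ->
  (forall i x, (i.+1 < n)%N -> P x -> P (hecke_T n i * x)) ->
  (forall i x, (i < n)%N -> P x -> P (hecke_C n i * x)) ->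
  forall i x, (i < n)%N -> P x -> P (hecke_h n i * x).
Proof.
move=> PD PZ PT PC; elim=> [|i IH] x li Px; first by rewrite /hecke_h hc_h0; apply: PC.
rewrite /hecke_h hc_hS -!mulrA mulrBl.
have P1 : P (hecke_h n i * (hecke_T n i * x)) by apply: IH; [lia|apply: PT].
apply: PD; first exact: PT.
by rewrite -mulNr -rmorphN; apply: PZ.
Qed.

Definition hecke_pi n : free_alg K (hc_gen n) -> H n :=
  fun y => quot_pi (@ahc_X1 K q n) (quot_pi (@ahc_relator K q n) y).

Lemma hecke_piE n y : hecke_pi y = free_lift (@hecke_gen K q n) y.
Proof.
pose f : {rmorphism _ -> _} := quot_pi (@ahc_X1 K q n) \o quot_pi (@ahc_relator K q n).
exact: (@free_lift_unique K _ _ f).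
Qed.

Lemma hecke_repr n (x : H n) : exists y, x = hecke_pi y.
Proof. by exists (repr (repr x)); rewrite /hecke_pi !quot_piK. Qed.

Lemma hecke_ind n (P : H n -> Prop) : P 1 ->
  (forall x y, P x -> P y -> P (x + y)) ->
  (forall a x, P x -> P (scal a * x)) ->
  (forall i x, (i.+1 < n)%N -> P x -> P (hecke_T n i * x)) ->
  (forall i x, (i < n)%N -> P x -> P (hecke_C n i * x)) ->
  forall x, P x.
Proof.
move=> P1 PD PZ PT PC x; have [y ->] := hecke_repr x.
have P0 : P 0 by rewrite -(mul0r 1) -(rmorph0 scal); apply: PZ.
have Ph := hecke_h_mull PD PZ PT PC.
rewrite hecke_piE; apply: big_ind => // w _; apply: PZ.
elim: (w : seq _) => [|g s IH]; first by rewrite big_nil.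
rewrite big_cons; case: g => i.
- by rewrite hecke_TE; apply: PT => //; have := ltn_ord i; lia.
- by rewrite hecke_X -mulrA; apply: PC => //; apply: Ph.
- by rewrite hecke_XV -mulrA; apply: Ph => //; apply: PC.
- by rewrite hecke_CE; apply: PC.
Qed.

End Generation.

Lemma hc_system_le (K : fieldType) (q : K) (A : centralAlgType K) m n (T C : nat -> A) :
  (m <= n)%N -> hc_system q n T C -> hc_system q m T C.
Proof.
move=> mn hc; split.
- by move=> i li; apply: (hcTT hc); lia.
- by move=> i j ij jm; apply: (hcTT_comm hc); lia.
- by move=> i li; apply: (hc_braid hc); lia.
- by move=> i li; apply: (hcCC hc); lia.
- by move=> i j ij jm; apply: (hcC_anti hc); lia.
- by move=> i li; apply: (hcTC hc); lia.
- by move=> i j li jm ji ji1; apply: (hcTC_comm hc); lia.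
Qed.

(** * The tower of algebras, the form tau and its Nakayama automorphism *)

(* Only the relations, the generation by the T_i and C_i, and the universal    *)
(* property of H(n) are used.                                                  *)
Section Tower.
Variables (K : fieldType) (q : K) (H : nat -> centralAlgType K).
Variables (T C : forall n, nat -> H n).
Hypothesis hs : forall n, hc_system q n (T n) (C n).
Hypothesis hgen : forall n (P : H n -> Prop), P 1 ->
  (forall x y, P x -> P y -> P (x + y)) ->
  (forall a x, P x -> P (scal a * x)) ->
  (forall i x, (i.+1 < n)%N -> P x -> P (T n i * x)) ->
  (forall i x, (i < n)%N -> P x -> P (C n i * x)) ->
  forall x, P x.
Hypothesis hlift : forall n (A : centralAlgType K) (T' C' : nat -> A),
  hc_system q n T' C' -> exists f : {rmorphism H n -> A},
  [/\ forall a, f (scal a) = scal a, forall i, (i.+1 < n)%N -> f (T n i) = T' i &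
      forall i, (i < n)%N -> f (C n i) = C' i].

Local Notation h n := (hc_h q (T n) (C n)).

(** * The inclusions H(m) -> H(m+1) and the parity involution *)

Section Inclusion.
Variable m : nat.

Let inc_sig := cid (hlift (hc_system_le (leqnSn m) (hs m.+1))).
Definition inc : {rmorphism H m -> H m.+1} := projT1 inc_sig.

Lemma inc_scal a : inc (scal a) = scal a.
Proof. by rewrite /inc; case: inc_sig => f []. Qed.

Lemma inc_T i : (i.+1 < m)%N -> inc (T m i) = T m.+1 i.
Proof. by rewrite /inc; case: inc_sig => f [] /= _ H1 _; apply: H1. Qed.

Lemma inc_C i : (i < m)%N -> inc (C m i) = C m.+1 i.
Proof. by rewrite /inc; case: inc_sig => f [] /= _ _; apply. Qed.

Lemma inc_h i : (i < m)%N -> inc (h m i) = h m.+1 i.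
Proof.
elim: i => [|i IH] im; first by rewrite !hc_h0 inc_C.
rewrite !hc_hS !rmorphM (rmorphB inc) inc_scal inc_T // IH //; lia.
Qed.

End Inclusion.

Section Sigma.
Variable n : nat.

Lemma sigma_system : hc_system q n (T n) (fun i => - C n i).
Proof.
have hc := hs n; split.
- exact: (hcTT hc).
- exact: (hcTT_comm hc).
- exact: (hc_braid hc).
- by move=> i li; rewrite mulrNN (hcCC hc).
- by move=> i j ij jn; rewrite !mulrNN (hcC_anti hc).
- by move=> i li; rewrite mulrN mulNr (hcTC hc).
- by move=> i j li jn ji ji1; rewrite mulrN mulNr (hcTC_comm hc).
Qed.

Let sigma_sig := cid (hlift sigma_system).
(** The parity automorphism, 1 on even and -1 on odd elements. *)
Definition sigma : {rmorphism H n -> H n} := projT1 sigma_sig.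

Lemma sigma_scal a : sigma (scal a) = scal a.
Proof. by rewrite /sigma; case: sigma_sig => f []. Qed.

Lemma sigma_T i : (i.+1 < n)%N -> sigma (T n i) = T n i.
Proof. by rewrite /sigma; case: sigma_sig => f [] /= _ H1 _; apply: H1. Qed.

Lemma sigma_C i : (i < n)%N -> sigma (C n i) = - C n i.
Proof. by rewrite /sigma; case: sigma_sig => f [] /= _ _; apply. Qed.

Lemma sigma_h i : (i < n)%N -> sigma (h n i) = - h n i.
Proof.
elim: i => [|i IH] im; first by rewrite hc_h0 sigma_C.
rewrite hc_hS !rmorphM (rmorphB sigma) sigma_scal sigma_T // IH; last by lia.
by rewrite mulrN mulNr.
Qed.

Lemma sigma_X i : (i < n)%N -> sigma (C n i * h n i) = C n i * h n i.
Proof. by move=> li; rewrite rmorphM sigma_C // sigma_h // mulrNN. Qed.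

Lemma sigma_XV i : (i < n)%N -> sigma (h n i * C n i) = h n i * C n i.
Proof. by move=> li; rewrite rmorphM sigma_C // sigma_h // mulrNN. Qed.

Lemma sigmaK x : sigma (sigma x) = x.
Proof.
move: x; apply: hgen => [|x y Ex Ey|a x Ex|i x im Ex|i x im Ex].
- by rewrite !rmorph1.
- by rewrite !rmorphD Ex Ey.
- by rewrite !rmorphM Ex !sigma_scal.
- by rewrite !rmorphM Ex !sigma_T.
- by rewrite !rmorphM Ex sigma_C // rmorphN sigma_C // opprK.
Qed.

End Sigma.

Lemma sigma_inc m x : sigma m.+1 (inc m x) = inc m (sigma m x).
Proof.
move: x; apply: hgen => [|x y Ex Ey|a x Ex|i x im Ex|i x im Ex].
- by rewrite !rmorph1.
- by rewrite !rmorphD Ex Ey.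
- by rewrite !rmorphM Ex sigma_scal !inc_scal sigma_scal.
- by rewrite !rmorphM Ex sigma_T // inc_T // sigma_T //; lia.
- by rewrite !rmorphM Ex sigma_C // rmorphN inc_C // sigma_C //; lia.
Qed.

Lemma C_inc m x : C m.+1 m * inc m x = inc m (sigma m x) * C m.+1 m.
Proof.
move: x; apply: hgen => [|x y Ex Ey|a x Ex|i x im Ex|i x im Ex].
- by rewrite !rmorph1 mul1r mulr1.
- by rewrite !rmorphD mulrDr mulrDl Ex Ey.
- by rewrite !rmorphM sigma_scal inc_scal mulrA -scalC -!mulrA Ex.
- rewrite !rmorphM sigma_T // inc_T // mulrA -(hcTC_comm (hs m.+1)); try lia.
  by rewrite -!mulrA Ex.
- rewrite !rmorphM sigma_C // rmorphN inc_C // mulrA.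
  by rewrite (hCC_anti (hs m.+1)) // ?mulNr; try lia; rewrite -!mulrA Ex.
Qed.

Lemma T_inc2 m x :
  T m.+2 m * inc m.+1 (inc m x) = inc m.+1 (inc m x) * T m.+2 m.
Proof.
move: x; apply: hgen => [|x y Ex Ey|a x Ex|i x im Ex|i x im Ex].
- by rewrite !rmorph1 mul1r mulr1.
- by rewrite !rmorphD mulrDr mulrDl Ex Ey.
- by rewrite !rmorphM !inc_scal mulrA -scalC -!mulrA Ex.
- rewrite !rmorphM !inc_T //; last by lia.
  by rewrite mulrA (hTT_comm (hs m.+2)) -?mulrA ?Ex //; lia.
- rewrite !rmorphM !inc_C //; last by lia.
  by rewrite mulrA (hcTC_comm (hs m.+2)) -?mulrA ?Ex //; lia.
Qed.

(** * The projection as a coefficient in the induced module *)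

Section Eps.
Variable m : nat.
Local Notation V := {ffun 'I_m.+1 * bool -> H m}.

Let rep_sig := cid (hlift (ind_hc_system (hs m))).
Definition rep : {rmorphism H m.+1 -> rend (H m) ('I_m.+1 * bool)%type} := projT1 rep_sig.

Lemma rep_scal a : rep (scal a) = scal a.
Proof. by rewrite /rep; case: rep_sig => f []. Qed.

Lemma rep_T i : (i.+1 < m.+1)%N -> rep (T m.+1 i) = indT q m (T m) (C m) i.
Proof. by rewrite /rep; case: rep_sig => f [] /= _ H1 _; apply: H1. Qed.

Lemma rep_C i : (i < m.+1)%N -> rep (C m.+1 i) = indC m (C m) i.
Proof. by rewrite /rep; case: rep_sig => f [] /= _ _; apply. Qed.

(** The generator u_m = 1 of the induced module. *)
Definition cyclic_vec : V := vec_of m (fun k b => if (k == m) && ~~ b then 1 else 0).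

Lemma coord_cyclic_vec k b : (k <= m)%N ->
  coord cyclic_vec k b = if (k == m) && ~~ b then 1 else 0.
Proof. exact: coord_vec_of. Qed.

Lemma coord_cyclic_vec_lt k b : (k < m)%N -> coord cyclic_vec k b = 0.
Proof. by move=> km; rewrite coord_cyclic_vec ?ltn_eqF // ltnW. Qed.

Lemma coord_cyclic_vec_m b : coord cyclic_vec m b = (~~ b)%:R.
Proof. by rewrite coord_cyclic_vec // eqxx; case: b. Qed.

Definition coef (x : H m.+1) k b : H m := coord (rep x cyclic_vec) k b.
Definition eps (x : H m.+1) : H m := coef x m false.

(** On the generator the left action of H(m) is right scaling; this makes [coef] right
    H(m)-linear. *)
Lemma rep_inc x : rep (inc m x) cyclic_vec = rscale cyclic_vec x.
Proof.
move: x; apply: hgen => [|x y Ex Ey|a x Ex|i x im Ex|i x im Ex].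
- rewrite !rmorph1; apply: coordP => k b km; by rewrite coord_rscale mulr1.
- by rewrite !rmorphD rendD Ex Ey; apply: coordP => k b km;
    rewrite coordD !coord_rscale mulrDr.
- rewrite rmorphM inc_scal rmorphM rep_scal rendM Ex.
  by apply: coordP => k b km; rewrite coord_scal !coord_rscale mulrA scalC -!mulrA.
- rewrite rmorphM inc_T // rmorphM rep_T ?rendM ?Ex; last by lia.
  apply: coordP => k b km; rewrite coord_indT // !coord_rscale.
  have [km'|->] : (k < m)%N \/ k = m by lia.
    rewrite !coord_cyclic_vec_lt //; try lia.
    by case: ifP => _; [|case: ifP => _; [|case: ifP => _; case: b]]; ncring.
  by rewrite ifT ?coord_cyclic_vec_m; [case: b; ncring|lia].
- rewrite rmorphM inc_C // rmorphM rep_C ?rendM ?Ex; last by lia.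
  apply: coordP => k b km; rewrite coord_indC // !coord_rscale.
  have [km'|->] : (k < m)%N \/ k = m by lia.
    by rewrite !coord_cyclic_vec_lt //; case: ifP => _; [|case: ifP => _]; ncring.
  by rewrite ifT ?coord_cyclic_vec_m //; case: b; rewrite ?expr0; ncring.
Qed.

Lemma coefD x y k b : coef (x + y) k b = coef x k b + coef y k b.
Proof. by rewrite /coef rmorphD rendD coordD. Qed.

Lemma coefN x k b : coef (- x) k b = - coef x k b.
Proof. by rewrite /coef rmorphN rendN coordN. Qed.

Lemma coef_scal a x k b : coef (scal a * x) k b = scal a * coef x k b.
Proof. by rewrite /coef rmorphM rep_scal rendM coord_scal. Qed.

Lemma coef_inc_r x a k b : coef (x * inc m a) k b = coef x k b * a.
Proof.
rewrite /coef rmorphM rendM rep_inc; case: (rep x) => f [fD fZ] /=.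
by rewrite fZ coord_rscale.
Qed.

Lemma coef1 k b : coef 1 k b = coord cyclic_vec k b.
Proof. by rewrite /coef rmorph1. Qed.

Lemma coef_T i x k b : (i < m)%N -> (k <= m)%N -> coef (T m.+1 i * x) k b =
  if (i.+1 < k)%N then T m i * coef x k b
  else if (k < i)%N then T m i.-1 * coef x k b
  else if k == i then
    coef x i.+1 b + (if b then 0
      else scal (q - q^-1) * coef x i false + scal (q - q^-1) * C m i * coef x i true)
  else
    coef x i b + (if b then scal (q - q^-1) * coef x i.+1 true
      else - (scal (q - q^-1) * C m i * coef x i.+1 true)).
Proof. by move=> im km; rewrite /coef rmorphM rep_T // rendM coord_indT. Qed.

Lemma coef_C j x k b : (j <= m)%N -> (k <= m)%N -> coef (C m.+1 j * x) k b =
  if (j < k)%N then (-1) ^+ b * C m j * coef x k b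
  else if (k < j)%N then (-1) ^+ b * C m j.-1 * coef x k b
  else coef x k (~~ b).
Proof. by move=> jm km; rewrite /coef rmorphM rep_C // rendM coord_indC. Qed.

Lemma epsD x y : eps (x + y) = eps x + eps y. Proof. exact: coefD. Qed.
Lemma epsN x : eps (- x) = - eps x. Proof. exact: coefN. Qed.
Lemma epsB x y : eps (x - y) = eps x - eps y. Proof. by rewrite epsD epsN. Qed.
Lemma eps_scal a x : eps (scal a * x) = scal a * eps x. Proof. exact: coef_scal. Qed.
Lemma eps_inc_r x a : eps (x * inc m a) = eps x * a. Proof. exact: coef_inc_r. Qed.

Lemma eps_inc_l a x : eps (inc m a * x) = a * eps x.
Proof.
move: a; apply: hgen => [|a b Ea Eb|c a Ea|i a im Ea|i a im Ea].
- by rewrite rmorph1 !mul1r.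
- by rewrite rmorphD !mulrDl epsD Ea Eb.
- by rewrite rmorphM inc_scal -!mulrA eps_scal Ea.
- by rewrite rmorphM inc_T // -!mulrA -Ea /eps coef_T ?ifT //; lia.
- rewrite rmorphM inc_C // -!mulrA -Ea /eps coef_C ?ifT //; try lia.
  by rewrite expr0 mul1r.
Qed.

Lemma eps1 : eps 1 = 1.
Proof. by rewrite /eps coef1 coord_cyclic_vec_m. Qed.

Lemma eps_inc a : eps (inc m a) = a.
Proof. by rewrite -[inc m a]mulr1 eps_inc_l eps1 mulr1. Qed.

Lemma eps_C : eps (C m.+1 m) = 0.
Proof. by rewrite -[C _ _]mulr1 /eps coef_C // ltnn coef1 coord_cyclic_vec_m. Qed.

End Eps.

Lemma eps_T m : eps (T m.+2 m) = 0.
Proof.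
rewrite -[T _ _]mulr1 /eps coef_T // ltnn ltnNge leqnSn /= ifF; last by lia.
by rewrite !coef1 coord_cyclic_vec_lt // coord_cyclic_vec_m mulr0 oppr0 addr0.
Qed.

Lemma eps_xTy m x y : eps (inc m.+1 x * T m.+2 m * inc m.+1 y) = 0.
Proof. by rewrite eps_inc_r eps_inc_l eps_T mulr0 mul0r. Qed.

(** * The decomposition H(m) T H(m) + H(m) + C_m H(m) *)

Lemma inc_C_sigma m x : inc m x * C m.+1 m = C m.+1 m * inc m (sigma m x).
Proof. by rewrite C_inc sigmaK. Qed.

Lemma TT_inc2 m x : T m.+2 m * inc m.+1 (inc m x) * T m.+2 m =
  scal (q - q^-1) * (T m.+2 m * inc m.+1 (inc m x)) + inc m.+1 (inc m x).
Proof.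
by rewrite T_inc2 -mulrA (hcTT (hs m.+2)) // mulrDr mulr1 epsCA.
Qed.

Lemma CT_top m : C m.+2 m.+1 * T m.+2 m = T m.+2 m * inc m.+1 (C m.+1 m).
Proof. by rewrite inc_C // (hcTC (hs m.+2)). Qed.

Lemma TC_top m : T m.+2 m * C m.+2 m.+1 = inc m.+1 (C m.+1 m) * T m.+2 m
  - scal (q - q^-1) * (inc m.+1 (C m.+1 m) - C m.+2 m.+1).
Proof. by rewrite inc_C // (hTC_r (hs m.+2)). Qed.

Lemma TCT_top m x : T m.+2 m * inc m.+1 (C m.+1 m * inc m x) * T m.+2 m =
  scal (q - q^-1) * (T m.+2 m * inc m.+1 (C m.+1 m * inc m x))
  + C m.+2 m.+1 * inc m.+1 (inc m x).
Proof.
rewrite rmorphM (mulrA (T _ _)) -CT_top -(mulrA (C _ _ * _)) -T_inc2 mulrA.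
rewrite -(mulrA (C _ _)) (hcTT (hs m.+2)) // mulrDr mulr1 epsCA.
by ncring.
Qed.

Lemma TxT'yT_top m x y (T' := T m.+2 m) (j := inc m.+2) (i := inc m.+1) :
  T m.+3 m.+1 * j (i x * T' * i y) * T m.+3 m.+1 =
  j (i x * T') * T m.+3 m.+1 * j (T' * i y).
Proof.
rewrite /j /i /T' !rmorphM !(mulrA (T m.+3 m.+1)) T_inc2 -!mulrA -T_inc2 !mulrA.
congr (_ * _); rewrite -!mulrA; congr (_ * _); rewrite !mulrA !inc_T //.
by rewrite (hc_braid (hs m.+3)).
Qed.

(** The sum of the three summands in impredicative form, which serves directly as an induction
    principle. *)
Definition dec_span m (x : H m.+1) := forall P : H m.+1 -> Prop,
  (forall x y, P x -> P y -> P (x + y)) ->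
  (forall a, P (inc m a)) -> (forall b, P (C m.+1 m * inc m b)) ->
  (forall i x y, i.+1 = m -> P (inc m x * T m.+1 i * inc m y)) -> P x.

Lemma dec_span_inc_mul m a (x : H m.+1) : dec_span x -> dec_span (inc m a * x).
Proof.
move=> Hx P PD Pi PC PT; apply: (Hx (fun x => P (inc m a * x))) => [u v Pu Pv|b|b|i y z im].
- by rewrite mulrDr; apply: (PD).
- by rewrite -rmorphM; apply: Pi.
- by rewrite mulrA inc_C_sigma -mulrA -rmorphM; apply: PC.
- by rewrite !mulrA -rmorphM; apply: PT.
Qed.

Lemma dec_span_C_mul m (x : H m.+1) : dec_span x -> dec_span (C m.+1 m * x).
Proof.
move=> Hx P PD Pi PC PT; apply: (Hx (fun x => P (C m.+1 m * x))) => [u v Pu Pv|b|b|i y z im].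
- by rewrite mulrDr; apply: (PD).
- exact: PC.
- by rewrite mulrA (hcCC (hs m.+1)) // mul1r.
- subst m; rewrite !mulrA C_inc -(mulrA (inc _ _)) CT_top !mulrA -mulrA -rmorphM.
  exact: PT.
Qed.

(** The critical product is T y T z with T = T_m and y in H(m+1). Decomposing y, the quadratic
    relation, the relation between T_m and C_m, and the braid relation each leave at most one T. *)
Lemma dec_span_T_mul m (x : H m.+2) : (forall y : H m.+1, dec_span y) -> dec_span x ->
  dec_span (T m.+2 m * x).
Proof.
move=> Hy Hx P PD Pi PC PT.
have PT1 y : P (T m.+2 m * inc m.+1 y).
  by rewrite -[T _ _]mul1r -(rmorph1 (inc m.+1)); apply: PT.
have PT2 (a : K) y : P (scal a * (T m.+2 m * inc m.+1 y)).
  by rewrite mulrA -(inc_scal m.+1); apply: PT.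
apply: (Hx (fun x => P (T m.+2 m * x))) => [u v Pu Pv|b|b|i y z [->{i}]].
- by rewrite mulrDr; apply: (PD).
- exact: PT1.
- rewrite mulrA TC_top mulrBl; apply: (PD); first exact: PT.
  have -> : - (scal (q - q^-1) * (inc m.+1 (C m.+1 m) - C m.+2 m.+1) * inc m.+1 b) =
      C m.+2 m.+1 * inc m.+1 (scal (q - q^-1) * b) +
      inc m.+1 (- (scal (q - q^-1) * (C m.+1 m * b))).
    by rewrite rmorphN !rmorphM !inc_scal epsCA; ncring.
  by apply: (PD); [exact: PC|exact: Pi].
- apply: (Hy y (fun y => P (T m.+2 m * (inc m.+1 y * T m.+2 m * inc m.+1 z))))
    => [u v Pu Pv|a|b|i u v im].
  + by rewrite rmorphD !mulrDl mulrDr; apply: (PD).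
  + rewrite !mulrA TT_inc2 mulrDl; apply: (PD); last by rewrite -rmorphM; apply: Pi.
    by rewrite -!mulrA -rmorphM; apply: PT2.
  + rewrite !mulrA TCT_top mulrDl -mulrA; apply: (PD).
      by rewrite -!mulrA -rmorphM; apply: PT2.
    by rewrite -!rmorphM; apply: PC.
  + subst m; rewrite !mulrA TxT'yT_top -mulrA -rmorphM; exact: PT.
Qed.

Lemma dec_span_all m (x : H m.+1) : dec_span x.
Proof.
elim: m x => [|m IHm] x.
  move: x; apply: hgen => [|x y Hx Hy|a x Hx|i x im Hx|i x im Hx].
  - by move=> P PD Pi PC PT; rewrite -(rmorph1 (inc _)).
  - by move=> P PD Pi PC PT; apply: (PD); [apply: Hx|apply: Hy].
  - by rewrite -(inc_scal 0); apply: dec_span_inc_mul.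
  - by lia.
  - have -> : i = 0%N by lia.
    exact: dec_span_C_mul.
move: x; apply: hgen => [|x y Hx Hy|a x Hx|i x im Hx|i x im Hx].
- by move=> P PD Pi PC PT; rewrite -(rmorph1 (inc _)).
- by move=> P PD Pi PC PT; apply: (PD); [apply: Hx|apply: Hy].
- by rewrite -(inc_scal m.+1); apply: dec_span_inc_mul.
- have [im'|->] : (i.+1 < m.+1)%N \/ i = m by lia.
    by rewrite -inc_T //; apply: dec_span_inc_mul.
  exact: dec_span_T_mul.
- have [im'|->] : (i < m.+1)%N \/ i = m.+1 by lia.
    by rewrite -inc_C //; apply: dec_span_inc_mul.
  exact: dec_span_C_mul.
Qed.

Lemma dec_ind m (P : H m.+1 -> Prop) :
  (forall x y, P x -> P y -> P (x + y)) ->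
  (forall a, P (inc m a)) -> (forall b, P (C m.+1 m * inc m b)) ->
  (forall i x y, i.+1 = m -> P (inc m x * T m.+1 i * inc m y)) ->
  forall x, P x.
Proof. by move=> PD Pi PC PT x; apply: (@dec_span_all m x P). Qed.

(** * Values of the projection on products with T_m *)

Lemma eps_Ty m y : eps (T m.+2 m * inc m.+1 y) = 0.
Proof. by rewrite eps_inc_r eps_T mul0r. Qed.

Lemma eps_xT m x : eps (inc m.+1 x * T m.+2 m) = 0.
Proof. by rewrite eps_inc_l eps_T mulr0. Qed.

Lemma eps_Cy m y : eps (C m.+1 m * inc m y) = 0.
Proof. by rewrite eps_inc_r eps_C mul0r. Qed.

Lemma eps_CxT m x : eps (C m.+2 m.+1 * inc m.+1 x * T m.+2 m) = 0.
Proof. by rewrite C_inc -mulrA CT_top mulrA eps_xTy. Qed.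

Lemma eps_TaT m a : eps (T m.+2 m * inc m.+1 a * T m.+2 m) = inc m (eps a).
Proof.
move: a; apply: dec_ind
  => [x y Ex Ey|b|b|i x y im].
- by rewrite rmorphD mulrDr mulrDl !epsD Ex Ey rmorphD.
- by rewrite TT_inc2 epsD eps_scal eps_Ty !eps_inc mulr0 add0r.
- by rewrite TCT_top epsD eps_scal eps_Ty !eps_Cy rmorph0 mulr0 add0r.
- by subst m; rewrite TxT'yT_top !eps_xTy rmorph0.
Qed.

Lemma hS_top m : h m.+2 m.+1 =
  T m.+2 m * inc m.+1 (h m.+1 m) * T m.+2 m
  - scal (q - q^-1) * (inc m.+1 (h m.+1 m) * T m.+2 m).
Proof. by rewrite hc_hS inc_h //; ncring. Qed.

Lemma eps_TaThT m a (T' := T m.+2 m) (j := inc m.+1) (hm := h m.+1 m) :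
  eps (T' * j (inc m a) * T' * j hm * T') =
  scal (q - q^-1) * inc m (eps (inc m a * hm)).
Proof.
rewrite /T' /j /hm TT_inc2 mulrDl mulrDl epsD -!(mulrA (scal _)) eps_scal.
by rewrite -(mulrA (T _ _)) -!rmorphM eps_TaT eps_xT addr0.
Qed.

Lemma eps_TCThT m b (T' := T m.+2 m) (j := inc m.+1) (hm := h m.+1 m) :
  eps (T' * j (C m.+1 m * inc m b) * T' * j hm * T') =
  scal (q - q^-1) * inc m (eps (C m.+1 m * inc m b * hm)).
Proof.
rewrite /T' /j /hm TCT_top mulrDl mulrDl epsD -!(mulrA (scal _)) eps_scal.
rewrite -(mulrA (T _ _)) -rmorphM eps_TaT.
by rewrite -(mulrA (C m.+2 m.+1)) -rmorphM eps_CxT addr0.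
Qed.

(** For g in H(m) + C_m H(m), reducing T g T leaves a term that [eps_TaT] evaluates. For g = x T y
    the braid relation brings in the previous level, and both sides vanish. *)
Lemma eps_TgThT m g (T' := T m.+2 m) (j := inc m.+1) (hm := h m.+1 m) :
  eps (T' * j g * T' * j hm * T') = scal (q - q^-1) * inc m (eps (g * hm)).
Proof.
rewrite /T' /j /hm {T' j hm}.
elim: m g => [|m IHm]; apply: dec_ind => [x y Ex Ey|b|b|i x y im];
  try (by rewrite rmorphD !(mulrDl, mulrDr) !epsD Ex Ey !(rmorphD, mulrDr));
  try exact: eps_TaThT; try exact: eps_TCThT; first by [].
case: im => ->{i}.
(* Expanding the top h as T h T - e h T, the induction hypothesis and [eps_TaT] give two equal terms
   that cancel. *)
have Z : eps (T m.+2 m * inc m.+1 y * h m.+2 m.+1) = 0.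
  rewrite hS_top mulrBr epsCA epsB eps_scal !mulrA IHm.
  by rewrite -(mulrA (T m.+2 m)) -rmorphM eps_TaT subrr.
transitivity (eps (inc m.+2 (inc m.+1 x * T m.+2 m) * (T m.+3 m.+1 *
    inc m.+2 (T m.+2 m * inc m.+1 y * h m.+2 m.+1) * T m.+3 m.+1))).
  by rewrite TxT'yT_top (rmorphM (inc m.+2) (T m.+2 m * inc m.+1 y)) !mulrA.
rewrite eps_inc_l eps_TaT Z rmorph0 mulr0.
have -> : inc m.+1 x * T m.+2 m * inc m.+1 y * h m.+2 m.+1 =
    inc m.+1 x * (T m.+2 m * inc m.+1 y * h m.+2 m.+1) by rewrite !mulrA.
by rewrite eps_inc_l Z mulr0 rmorph0 mulr0.
Qed.

Lemma eps_h m : eps (h m.+1 m) = 0.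
Proof.
elim: m => [|m IH]; first by rewrite hc_h0 eps_C.
by rewrite hS_top epsB eps_scal eps_TaT IH eps_xT rmorph0 mulr0 subrr.
Qed.

Lemma eps_Ch m : eps (C m.+1 m * h m.+1 m) = 1.
Proof.
elim: m => [|m IH]; first by rewrite hc_h0 (hcCC (hs 1)) // eps1.
rewrite hS_top mulrBr epsCA epsB eps_scal !mulrA CT_top -(mulrA (T _ _)) -rmorphM.
by rewrite eps_TaT IH eps_CxT rmorph1 mulr0 subr0.
Qed.

Lemma eps_sigma m x : eps (sigma m.+1 x) = sigma m (eps x).
Proof.
move: x; apply: dec_ind => [x y Ex Ey|b|b|i x y im].
- by rewrite rmorphD !epsD Ex Ey rmorphD.
- by rewrite sigma_inc !eps_inc.
- by rewrite rmorphM sigma_inc sigma_C // mulNr epsN !eps_Cy oppr0 rmorph0.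
- by subst m; rewrite !rmorphM !sigma_inc sigma_T // !eps_xTy rmorph0.
Qed.

(** * The form tau and its Nakayama automorphism *)

Lemma scal0_surj (x : H 0) : exists c : K, x = scal c.
Proof.
move: x; apply: hgen => // [|x y [a ->] [b ->]|c x [a ->]].
- by exists 1; rewrite rmorph1.
- by exists (a + b); rewrite rmorphD.
- by exists (c * a); rewrite rmorphM.
Qed.

Lemma scal0_inj : injective (scal : K -> H 0).
Proof.
(* Any algebra into which K embeds serves here, since for n = 0 the relations are vacuous. *)
pose A : centralAlgType K := free_alg K bool.
have hc0 : hc_system q 0 (fun _ => 0 : A) (fun _ => 0 : A) by split.
have [f [fs _ _]] := hlift hc0.
move=> a b /(congr1 f); rewrite !fs => /eqP.
by rewrite malgC_eq => /eqP.
Qed.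

Definition val0 (x : H 0) : K := projT1 (cid (scal0_surj x)).

Lemma val0K x : scal (val0 x) = x.
Proof. by rewrite /val0; case: cid. Qed.

Fixpoint tau n : H n -> K :=
  match n with
  | 0 => val0
  | m.+1 => fun x => tau (eps x)
  end.

Lemma tauS m (x : H m.+1) : tau x = tau (eps x). Proof. by []. Qed.

Lemma tauD n (x y : H n) : tau (x + y) = tau x + tau y.
Proof.
elim: n x y => [|n IH] x y; last by rewrite !tauS epsD IH.
by apply: scal0_inj; rewrite rmorphD /= !val0K.
Qed.

Lemma tau_scal n a (x : H n) : tau (scal a * x) = a * tau x.
Proof.
elim: n x => [|n IH] x; last by rewrite !tauS eps_scal IH.
by apply: scal0_inj; rewrite rmorphM /= !val0K.
Qed.

Lemma tau0 n : tau (0 : H n) = 0.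
Proof. by rewrite -(mul0r 0) -(rmorph0 scal) tau_scal mul0r. Qed.

Lemma tauN n (x : H n) : tau (- x) = - tau x.
Proof. by apply/eqP; rewrite -subr_eq0 opprK -tauD addNr tau0. Qed.

Lemma tau_sigma n (x : H n) : tau (sigma n x) = tau x.
Proof.
elim: n x => [|n IH] x; last by rewrite !tauS eps_sigma IH.
by rewrite -(val0K x) sigma_scal.
Qed.

(* [nak x x']: the Nakayama automorphism of tau sends x to x' *)
Definition nak n (x x' : H n) := forall w, tau (x * w) = tau (w * x').

Lemma nak1 n : nak (1 : H n) 1. Proof. by move=> w; rewrite mul1r mulr1. Qed.

Lemma nakM n (x x' y y' : H n) : nak x x' -> nak y y' -> nak (x * y) (x' * y').
Proof. by move=> Hx Hy w; rewrite -mulrA Hx -mulrA Hy mulrA. Qed.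

Lemma nakD n (x x' y y' : H n) : nak x x' -> nak y y' -> nak (x + y) (x' + y').
Proof. by move=> Hx Hy w; rewrite mulrDl mulrDr !tauD Hx Hy. Qed.

Lemma nak_scal n a : nak (scal a : H n) (scal a).
Proof. by move=> w; rewrite scalC. Qed.

Lemma nak_inc m (x x' : H m) : nak x x' -> nak (inc m x) (inc m x').
Proof. by move=> Hx w; rewrite !tauS eps_inc_l eps_inc_r Hx. Qed.

Local Notation N m := (T m.+2 m - scal (q - q^-1) * (h m.+2 m * h m.+2 m.+1)).

Lemma N_top m : N m = T m.+2 m + scal (q - q^-1) * scal (q - q^-1) * T m.+2 m
  - scal (q - q^-1) *
    (inc m.+1 (h m.+1 m) * T m.+2 m * inc m.+1 (h m.+1 m) * T m.+2 m).
Proof.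
have hh1 : inc m.+1 (h m.+1 m) * inc m.+1 (h m.+1 m) = 1.
  by rewrite -rmorphM (h_sq (hs m.+1)) // rmorph1.
rewrite hS_top -inc_h // mulrBr epsCA (mulrA (inc _ _) (inc _ _)) hh1 mul1r.
by ncring.
Qed.

Lemma eps_N m v : eps (v * N m) =
  eps (v * T m.+2 m) + scal (q - q^-1) * (scal (q - q^-1) * eps (v * T m.+2 m))
  - scal (q - q^-1) * eps (v * inc m.+1 (h m.+1 m) * T m.+2 m
      * inc m.+1 (h m.+1 m) * T m.+2 m).
Proof.
rewrite N_top mulrBr mulrDr epsB epsD -(mulrA (scal _)) !epsCA !eps_scal.
by rewrite !mulrA.
Qed.

(** Tested on the summands: on H(m+1) both sides vanish; on C_(m+1) H(m+1) it becomes the assumption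
    on C_m, by invariance of tau under parity; on x T y, by [eps_TgThT], both sides become
    tau(eps(x) eps(y)). *)
Lemma nak_T_top m : nak (C m.+1 m) (h m.+1 m) -> nak (T m.+2 m) (N m).
Proof.
move=> nC; apply: dec_ind => [x y Ex Ey|b|b|i x y [->{i}]].
- by rewrite mulrDr mulrDl !tauD Ex Ey.
- rewrite !tauS eps_N eps_Ty eps_xT -rmorphM -!mulrA eps_inc_l (mulrA (T _ _)).
  by rewrite eps_TaT eps_h rmorph0 !mulr0 addr0 subrr.
- have E1 : eps (T m.+2 m * (C m.+2 m.+1 * inc m.+1 b)) =
      - (scal (q - q^-1) * (C m.+1 m * b)).
    rewrite mulrA TC_top mulrBl epsB eps_xTy -(mulrA (scal _)) eps_scal mulrBl epsB.
    by rewrite -rmorphM eps_inc eps_Cy subr0 add0r.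
  have E2 : eps (C m.+2 m.+1 * inc m.+1 b * inc m.+1 (h m.+1 m) * T m.+2 m
      * inc m.+1 (h m.+1 m) * T m.+2 m) = sigma m.+1 (b * h m.+1 m).
    rewrite -(mulrA (C _ _)) -rmorphM C_inc -(mulrA _ (C _ _) (T _ _)) CT_top.
    rewrite (mulrA (inc _ _) (T _ _)) -(mulrA (_ * T _ _)) -rmorphM -!mulrA eps_inc_l.
    by rewrite (mulrA (T _ _)) eps_TaT eps_Ch rmorph1 mulr1.
  rewrite [LHS]tauS [RHS]tauS E1 eps_N E2 eps_CxT !mulr0 !add0r !tauN !tau_scal tau_sigma.
  by rewrite nC.
- rewrite [LHS]tauS [RHS]tauS eps_N.
  have -> : eps (inc m.+1 x * T m.+2 m * inc m.+1 y * T m.+2 m) = x * inc m (eps y).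
    by rewrite -!(mulrA (inc _ x)) eps_inc_l eps_TaT.
  have -> : eps (inc m.+1 x * T m.+2 m * inc m.+1 y * inc m.+1 (h m.+1 m) * T m.+2 m
      * inc m.+1 (h m.+1 m) * T m.+2 m) =
      x * (scal (q - q^-1) * inc m (eps y)).
    rewrite -!(mulrA (inc _ x)) eps_inc_l -(mulrA (T _ _)) -rmorphM eps_TgThT.
    by rewrite -mulrA (h_sq (hs m.+1)) // mulr1.
  rewrite (epsCA _ x) addrK.
  rewrite !mulrA eps_inc_r eps_TaT.
  by rewrite !tauS eps_inc_l eps_inc_r.
Qed.

(** The Nakayama correspondence is multiplicative, C_(m+1) = T C_m T^-1, and h_(m+1) = N h_m N^-1
    with N the image of T. *)
Lemma nak_C_top_S m : nak (C m.+1 m) (h m.+1 m) ->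
  nak (C m.+2 m.+1) (h m.+2 m.+1).
Proof.
move=> nC; have li : (m.+1 < m.+2)%N by [].
have nT := nak_T_top nC; have nC' := nak_inc nC.
have -> : C m.+2 m.+1 = T m.+2 m * inc m.+1 (C m.+1 m) * (T m.+2 m + scal (- (q - q^-1))).
  by rewrite -CT_top rmorphN -mulrA (hTTV (hs m.+2)) // mulr1.
have -> : h m.+2 m.+1 = N m * inc m.+1 (h m.+1 m) * (N m + scal (- (q - q^-1))).
  by rewrite rmorphN inc_h // (N_h (hs m.+2)) // -mulrA (N_inv (hs m.+2)) // mulr1.
by apply: nakM; [exact: nakM | apply: nakD => //; exact: nak_scal].
Qed.

Lemma nak_C_top m : nak (C m.+1 m) (h m.+1 m).
Proof.
elim: m => [|m IH]; last exact: nak_C_top_S.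
(* Parity is trivial on H(0) = K, so C_0 is central in H(1). *)
have sg (x : H 0) : sigma 0 x = x by have [c ->] := scal0_surj x; rewrite sigma_scal.
rewrite hc_h0 => w; congr tau; move: w; apply: dec_ind => // [x y Ex Ey|b|b].
- by rewrite mulrDr mulrDl Ex Ey.
- by rewrite C_inc sg.
- by rewrite -mulrA inc_C_sigma sg.
Qed.

Lemma nak_C n i : (i < n)%N -> nak (C n i) (h n i).
Proof.
elim: n => // n IH li; have [li'|->] : (i < n)%N \/ i = n by lia.
  by rewrite -inc_C // -inc_h //; apply/nak_inc/IH.
exact: nak_C_top.
Qed.

Lemma nak_T n i : (i.+1 < n)%N ->
  nak (T n i) (T n i - scal (q - q^-1) * (h n i * h n i.+1)).
Proof.
elim: n => // n IH li; have [li'|ei] : (i.+1 < n)%N \/ n = i.+1 by lia.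
  rewrite -inc_T // -(inc_h (ltnW li')) -(inc_h li') -rmorphM -inc_scal -rmorphM -rmorphB.
  exact/nak_inc/IH.
by subst n; apply: nak_T_top; apply: nak_C_top.
Qed.

(** * The product of the 1 + X_i twists tau into a trace *)

Local Notation Xi n i := (C n i * h n i).

Definition prod_one_X n : H n := \prod_(0 <= i < n) (1 + Xi n i).

Lemma prod_one_X_split n i : (i < n)%N -> prod_one_X n =
  \prod_(0 <= j < i) (1 + Xi n j) * (1 + Xi n i) * \prod_(i.+1 <= j < n) (1 + Xi n j).
Proof.
by move=> li; rewrite /prod_one_X (big_cat_nat (leq0n i) (ltnW li)) /= (big_ltn li) mulrA.
Qed.

Lemma comm_prod_X n lo hi (x : H n) : (hi <= n)%N ->
  (forall j, (lo <= j < hi)%N -> x * Xi n j = Xi n j * x) ->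
  x * \prod_(lo <= j < hi) (1 + Xi n j) = \prod_(lo <= j < hi) (1 + Xi n j) * x.
Proof.
move=> hin xX; rewrite !big_seq; apply: commr_prod => j.
by rewrite mem_index_iota => /xX H1; apply: commrD; [exact: commr1|].
Qed.

Lemma prod_one_X_C n i : (i < n)%N -> prod_one_X n * h n i = C n i * prod_one_X n.
Proof.
move=> li; rewrite (prod_one_X_split li).
set P1 := \prod_(0 <= j < i) _; set P2 := \prod_(i.+1 <= j < n) _.
have hX x j : (j < n)%N -> j != i -> x = C n i \/ x = h n i -> x * Xi n j = Xi n j * x.
  by move=> lj ji [|] ->; rewrite ?(X_C_comm (hs n)) ?(X_h_comm (hs n)).
have c1 : C n i * P1 = P1 * C n i.
  by apply: comm_prod_X; [lia|move=> j lj; apply: hX; [lia|lia|left]].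
have c2 : h n i * P2 = P2 * h n i.
  by apply: comm_prod_X; [lia|move=> j lj; apply: hX; [lia|lia|right]].
rewrite -(mulrA _ P2) -c2 mulrA -(mulrA P1) (one_X_h (hs n)) // !mulrA c1.
by [].
Qed.

(** The factors before i commute with T_i and those after i+1 with its Nakayama image, so [TX2] on
    the two middle factors suffices. *)
Lemma prod_one_X_T n i : (i.+1 < n)%N ->
  prod_one_X n * (T n i - scal (q - q^-1) * (h n i * h n i.+1)) = T n i * prod_one_X n.
Proof.
move=> li; have li' : (i < n)%N by lia.
rewrite (prod_one_X_split li') (big_ltn li).
set P1 := \prod_(0 <= j < i) _; set P2 := \prod_(i.+2 <= j < n) _.
set M := T n i - _.
have c1 : T n i * P1 = P1 * T n i.
  by apply: comm_prod_X; [lia|move=> j lj; apply: (TX_comm (hs n)); lia].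
have c2 : M * P2 = P2 * M.
  apply: comm_prod_X; [lia|move=> j lj].
  have cX k : (k < n)%N -> k != j -> h n k * Xi n j = Xi n j * h n k.
    by move=> lk kj; rewrite (X_h_comm (hs n)) //; [lia|rewrite eq_sym].
  rewrite /M mulrBl mulrBr (TX_comm (hs n)); try lia.
  rewrite epsCA -(mulrA (scal _)) -(mulrA (h n i)) cX; try lia.
  by rewrite mulrA cX; try lia; rewrite !mulrA.
rewrite (mulrA _ (1 + _) P2) -(mulrA _ P2) -c2 !mulrA -!(mulrA P1) (TX2 (hs n)) //.
by rewrite !mulrA c1.
Qed.

(** The automorphism is never built as a map: each x gets a partner x' with both properties at once,
    by induction on x. *)
Lemma nak_prod_one_X n (x : H n) :
  exists2 x', nak x x' & prod_one_X n * x' = x * prod_one_X n.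
Proof.
move: x; apply: hgen => [|x y [x' nx zx] [y' ny zy]|a x [x' nx zx]|i x li [x' nx zx]
  |i x li [x' nx zx]].
- by exists 1; [exact: nak1|rewrite mul1r mulr1].
- by exists (x' + y'); [exact: nakD|rewrite mulrDr mulrDl zx zy].
- exists (scal a * x'); first by apply: nakM => //; exact: nak_scal.
  by rewrite mulrA -scalC -!mulrA zx.
- exists ((T n i - scal (q - q^-1) * (h n i * h n i.+1)) * x').
    by apply: nakM => //; exact: nak_T.
  by rewrite mulrA prod_one_X_T // -!mulrA zx.
- exists (h n i * x'); first by apply: nakM => //; exact: nak_C.
  by rewrite mulrA prod_one_X_C // -!mulrA zx.
Qed.

Lemma tau_trace n (x y : H n) : tau (x * y * prod_one_X n) = tau (y * x * prod_one_X n).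
Proof.
by have [x' nx zx] := nak_prod_one_X x; rewrite -mulrA nx -mulrA zx mulrA.
Qed.

Lemma sigma_prod_one_X n : sigma n (prod_one_X n) = prod_one_X n.
Proof.
rewrite /prod_one_X rmorph_prod; apply: eq_big_nat => i /andP[_ li].
by rewrite rmorphD rmorph1 rmorphM sigma_C // sigma_h // mulrNN.
Qed.

(** * The basis of H(m+1) over H(m) and non-degeneracy of tau *)

Definition coset_word m k : H m.+1 := \prod_(k <= i < m) T m.+1 i.
Definition coset_basis m k b : H m.+1 := (if b then C m.+1 k else 1) * coset_word m k.

Lemma coset_word_top m : coset_word m m = 1. Proof. by rewrite /coset_word big_geq. Qed.

Lemma coset_word_rec m k : (k < m)%N -> coset_word m k = T m.+1 k * coset_word m k.+1.
Proof. by move=> km; rewrite /coset_word big_ltn. Qed.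

Lemma coset_word_inc m k : (k <= m)%N ->
  coset_word m.+1 k = inc m.+1 (coset_word m k) * T m.+2 m.
Proof.
move=> km; rewrite /coset_word big_nat_recr //= rmorph_prod; congr (_ * _).
by apply: eq_big_nat => i /andP[_ im]; rewrite inc_T.
Qed.

Lemma coef_coset_word m k k' b : (k <= m)%N -> (k' <= m)%N ->
  coef (coset_word m k) k' b = ((k' == k) && ~~ b)%:R.
Proof.
move=> km; move: k' b; rewrite -(subKn km).
elim: (m - k)%N (leq_subr k m) => [|d IH] dm k' b km'.
  by rewrite subn0 coset_word_top coef1 coord_cyclic_vec //; case: (_ && _).
have lt : (m - d.+1 < m)%N by lia.
have {}IH := IH (ltnW dm); rewrite (_ : m - d = (m - d.+1).+1)%N in IH; last by lia.
rewrite coset_word_rec // coef_T //; move: lt IH; move: (m - d.+1)%N => j jm IH.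
case: ifP => [lt|ge]; first by rewrite IH // (gtn_eqF lt) (gtn_eqF (ltnW lt)) mulr0.
case: ifP => [lt|ge']; first by rewrite IH // ltn_eqF ?(ltn_eqF lt) ?mulr0 //; lia.
case: ifP => _.
  rewrite !IH //; try lia.
  by rewrite eqxx ltn_eqF // !mulr0 addr0; case: b; rewrite addr0.
rewrite !IH //; try lia.
by rewrite eqxx ltn_eqF //= !mulr0 oppr0; case: b; rewrite addr0.
Qed.

(** The coefficients are dual to the C_k^b u_k, which gives freeness. *)
Lemma coef_coset_basis m k b k' b' : (k <= m)%N -> (k' <= m)%N ->
  coef (coset_basis m k b) k' b' = ((k' == k) && (b' == b))%:R.
Proof.
move=> km km'; rewrite /coset_basis; case: b; last by rewrite mul1r coef_coset_word //; case: b'.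
rewrite coef_C //; case: ltngtP => [lt|lt|->].
- by rewrite coef_coset_word // gtn_eqF // mulr0.
- by rewrite coef_coset_word // ltn_eqF // mulr0.
- by rewrite coef_coset_word // eqxx negbK; case: b'.
Qed.

Lemma coef0 m k b : coef (0 : H m.+1) k b = 0.
Proof. by rewrite -(mul0r 0) -(rmorph0 scal) coef_scal rmorph0 mul0r. Qed.

Lemma coef_sum m (I : Type) (r : seq I) (F : I -> H m.+1) k b :
  coef (\sum_(i <- r) F i) k b = \sum_(i <- r) coef (F i) k b.
Proof.
by apply: (big_morph (fun x => coef x k b)); [move=> x y; exact: coefD|exact: coef0].
Qed.

(** In a summand x T y, expand x one level down: its coefficients commute with T, and u_k T is the
    coset word of the new level. *)
Lemma coset_basis_span m (x : H m.+1) : exists a : nat -> bool -> H m,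
  x = \sum_(0 <= k < m.+1) \sum_(b : bool) coset_basis m k b * inc m (a k b).
Proof.
have top n (f : bool -> H n) : exists a : nat -> bool -> H n,
    \sum_(b : bool) coset_basis n n b * inc n (f b) =
    \sum_(0 <= k < n.+1) \sum_(b : bool) coset_basis n k b * inc n (a k b).
  exists (fun k b => if k == n then f b else 0).
  rewrite big_nat_recr //= eqxx [X in _ = X + _]big1_seq ?add0r // => k /andP[_].
  rewrite mem_index_iota => /andP[_ kn].
  by rewrite ltn_eqF // big1 // => b _; rewrite rmorph0 mulr0.
elim: m x => [|m IHm]; apply: dec_ind => [x y [a ->] [b ->]|c|c|i x y im].
1,5: exists (fun k s => a k s + b k s); rewrite -big_split /=; apply: eq_bigr => k _;
  rewrite -big_split /=; apply: eq_bigr => s _; by rewrite rmorphD mulrDr.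
1,4: have [a aE] := top _ (fun b => if b then 0 else c); exists a; rewrite -aE big_bool;
  by rewrite /= rmorph0 mulr0 add0r /coset_basis coset_word_top !mul1r.
1,3: have [a aE] := top _ (fun b => if b then c else 0); exists a; rewrite -aE big_bool;
  by rewrite /= rmorph0 mulr0 addr0 /coset_basis coset_word_top mulr1.
- by [].
case: im => ->{i}; have [a ->] := IHm x.
exists (fun k b => if (k < m.+1)%N then inc m (a k b) * y else 0).
rewrite [RHS]big_nat_recr //= ltnn [X in _ = _ + X]big1 ?addr0; last first.
  by move=> b _; rewrite rmorph0 mulr0.
rewrite rmorph_sum !mulr_suml; apply: eq_big_nat => k /andP[_ km].
rewrite rmorph_sum !mulr_suml; apply: eq_bigr => b _.
rewrite km rmorphM -(mulrA _ _ (T _ _)) -T_inc2 !mulrA -!mulrA rmorphM !mulrA.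
congr (_ * _ * _); rewrite /coset_basis coset_word_inc // rmorphM !mulrA; congr (_ * _ * _).
by case: b; rewrite ?rmorph1 ?inc_C.
Qed.

Lemma coef_expand m (x : H m.+1) :
  x = \sum_(k < m.+1) \sum_(b : bool) coset_basis m k b * inc m (coef x k b).
Proof.
have [a ax] := coset_basis_span x.
have ac k b : (k <= m)%N -> coef x k b = a k b.
  move=> km; rewrite ax coef_sum (bigD1_seq k) ?mem_index_iota ?iota_uniq //=.
  rewrite [X in _ + X]big1_seq; last first.
    move=> j /andP[jk]; rewrite mem_index_iota => /andP[_ jm].
    rewrite coef_sum big1 // => s _.
    by rewrite coef_inc_r coef_coset_basis // eq_sym (negbTE jk) mul0r.
  rewrite addr0 coef_sum (bigD1 b) //= big1 ?addr0 => [|s sb].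
    by rewrite coef_inc_r coef_coset_basis // !eqxx mul1r.
  by rewrite coef_inc_r coef_coset_basis // eqxx eq_sym (negbTE sb) mul0r.
rewrite [LHS]ax big_mkord; apply: eq_bigr => k _; apply: eq_bigr => b _.
by rewrite ac // -ltnS.
Qed.

Lemma coef_inj m (x : H m.+1) :
  (forall k b, (k <= m)%N -> coef x k b = 0) -> x = 0.
Proof.
move=> x0; rewrite (coef_expand x) big1 // => k _; rewrite big1 // => b _.
by rewrite x0 ?rmorph0 ?mulr0 // -ltnS.
Qed.

(** Multiplying by 1 and C_m exposes the two coefficients at k = m. Then T_j moves the coefficient
    at j to j+1, modulo coefficients already known to vanish, so a descending induction kills all of
    them. *)
Lemma eps_nondeg m (x : H m.+1) : (forall y, eps (y * x) = 0) -> x = 0.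
Proof.
move=> Zx; apply: coef_inj => k b km.
rewrite -(subKn km); elim: (m - k)%N (leq_subr k m) x Zx b => {k km} [|d IH] dm x Zx b.
  rewrite subn0; case: b; last by rewrite -[x]mul1r; exact: Zx.
  by have := Zx (C m.+1 m); rewrite /eps coef_C // ltnn.
have Zw w y : eps (y * (w * x)) = 0 by rewrite mulrA.
have {}IH x' := IH (ltnW dm) x'.
rewrite (_ : m - d = (m - d.+1).+1)%N in IH; last by lia.
have lt : (m - d.+1 < m)%N by lia.
move: lt IH; move: (m - d.+1)%N => j jm IH.
have := IH (T m.+1 j * x) (Zw _) b; rewrite coef_T // ltnn ltnNge leqnSn /=.
rewrite ifF; last by lia.
by rewrite (IH x) // !mulr0 oppr0; case: b; rewrite addr0.
Qed.

Lemma tau_nondeg n (x : H n) : (forall y, tau (y * x) = 0) -> x = 0.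
Proof.
elim: n x => [|n IH] x tx.
  by have := tx 1; rewrite mul1r /= -[x in _ -> x = 0]val0K => ->; rewrite rmorph0.
apply: eps_nondeg => y; apply: IH => y'.
by rewrite -eps_inc_l mulrA; exact: tx.
Qed.

Lemma sigma_coset_basis m k b : (k <= m)%N ->
  sigma m.+1 (coset_basis m k b) = (-1) ^+ b * coset_basis m k b.
Proof.
move=> km; have su : sigma m.+1 (coset_word m k) = coset_word m k.
  rewrite /coset_word rmorph_prod; apply: eq_big_nat => i /andP[_ im].
  by rewrite sigma_T.
rewrite /coset_basis rmorphM su; case: b; last by rewrite rmorph1 !mul1r.
by rewrite sigma_C // expr1 mulN1r mulNr.
Qed.

(** Products of coset bases along the tower; [coef] isolates one coset at a time and reduces
    independence to the previous level. *)
Lemma homogeneous_tower_basis n : exists (I : finType) (b : I -> H n),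
  [/\ forall i, exists s : bool, sigma n (b i) = (-1) ^+ s * b i,
      forall x, exists c : I -> K, x = \sum_i scal (c i) * b i
    & forall c : I -> K, \sum_i scal (c i) * b i = 0 -> forall i, c i = 0].
Proof.
elim: n => [|m [I [b [bs bspan bfree]]]].
  exists unit, (fun _ => 1); split.
  - by exists false; rewrite rmorph1 mulr1.
  - move=> x; have [c ->] := scal0_surj x; exists (fun _ => c).
    by rewrite (bigD1 tt) //= big1 ?addr0 ?mulr1 // => -[].
  - move=> c c0 []; apply: scal0_inj; rewrite rmorph0 -[RHS]c0.
    by rewrite (bigD1 tt) //= big1 ?addr0 ?mulr1 // => -[].
exists ('I_m.+1 * bool * I)%type.
exists (fun p : 'I_m.+1 * bool * I => coset_basis m p.1.1 p.1.2 * inc m (b p.2)).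
split.
- move=> [[k s] i] /=; have [s' E] := bs i; exists (s (+) s').
  rewrite rmorphM sigma_coset_basis -1?ltnS // sigma_inc E rmorphM rmorphXn rmorphN1.
  by case: s; case: s' E => _; rewrite ?expr0 ?expr1 /=; ncring.
- move=> x; have /choice[c cE] : forall p : 'I_m.+1 * bool, exists c : I -> K,
      coef x p.1 p.2 = \sum_i scal (c i) * b i by move=> p; exact: bspan.
  exists (fun p => c p.1 p.2); rewrite [LHS]coef_expand pair_bigA /=.
  transitivity (\sum_(p : 'I_m.+1 * bool) \sum_i
      scal (c p i) * (coset_basis m p.1 p.2 * inc m (b i))); last by rewrite pair_bigA.
  apply: eq_bigr => p _; rewrite (cE p) rmorph_sum mulr_sumr; apply: eq_bigr => i _.
  by rewrite rmorphM inc_scal mulrA -scalC -mulrA.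
- move=> c c0 [[k s] i] /=; move: i; apply: (bfree (fun i => c (k, s, i))).
  have E : \sum_(p : 'I_m.+1 * bool) \sum_i
      coef (scal (c (p, i)) * (coset_basis m p.1 p.2 * inc m (b i))) k s = 0.
    rewrite pair_bigA /= -[RHS](coef0 m k s) -c0 coef_sum.
    by apply: eq_bigr => -[[k' s'] i].
  rewrite -[RHS]E; symmetry.
  rewrite (bigD1 (k, s)) //= [X in _ + X = _]big1 ?addr0 => [|[k' s'] ne].
    apply: eq_bigr => i _; rewrite coef_scal coef_inc_r coef_coset_basis -1?ltnS //.
    by rewrite !eqxx mul1r.
  rewrite big1 // => i _; rewrite coef_scal coef_inc_r coef_coset_basis -1?ltnS //=.
  have -> : (k == k' :> nat) && (s == s') = false.
    by apply: contraNF ne; rewrite xpair_eqE -val_eqE /= eq_sym (eq_sym s).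
  by rewrite mul0r mulr0.
Qed.

(** Here and in [decomp], E stands for H(m) T H(m); only its closure properties and the vanishing of
    [eps] on it matter. *)
Lemma eps_decomp m (E : H m.+1 -> Prop) (h : H m.+1) (a : H m) :
  (forall z, E z -> eps z = 0) ->
  (exists z b, E z /\ h = z + inc m a + C m.+1 m * inc m b) -> eps h = a.
Proof.
by move=> E0 [z [b [/E0 z0 ->]]]; rewrite !epsD z0 eps_inc eps_Cy add0r addr0.
Qed.

Lemma decomp m (E : H m.+1 -> Prop) : E 0 ->
  (forall x y, E x -> E y -> E (x + y)) ->
  (forall i x y, i.+1 = m -> E (inc m x * T m.+1 i * inc m y)) ->
  forall h : H m.+1, exists a z b, E z /\ h = z + inc m a + C m.+1 m * inc m b.
Proof.
move=> E0 ED ET; apply: dec_ind => [x y|c|c|i x y im].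
- move=> [a [z [b [Ez ->]]]] [a' [z' [b' [Ez' ->]]]].
  exists (a + a'), (z + z'), (b + b'); split; first exact: ED.
  by rewrite !rmorphD; ncring.
- by exists c, 0, 0; split; rewrite // rmorph0 mulr0 add0r addr0.
- by exists 0, 0, c; split; rewrite // rmorph0 !add0r.
- exists 0, (inc m x * T m.+1 i * inc m y), 0; split; first exact: ET.
  by rewrite !rmorph0 mulr0 !addr0.
Qed.

Lemma inc_unique m (f : {rmorphism H m -> H m.+1}) : (forall a, f (scal a) = scal a) ->
  (forall i, (i.+1 < m)%N -> f (T m i) = T m.+1 i) ->
  (forall i, (i < m)%N -> f (C m i) = C m.+1 i) -> f =1 inc m.
Proof.
move=> fs fT fC; apply: hgen => [|x y Ex Ey|a x Ex|i x im Ex|i x im Ex].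
- by rewrite !rmorph1.
- by rewrite !rmorphD Ex Ey.
- by rewrite !rmorphM Ex fs inc_scal.
- by rewrite !rmorphM Ex fT // inc_T.
- by rewrite !rmorphM Ex fC // inc_C.
Qed.

(** * The grading by parity and the symmetrizing form *)

Definition sigma_parity n (b : bool) (x : H n) : Prop := sigma n x = (-1) ^+ b * x.

Hypothesis char2 : 2%:R != 0 :> K.

Lemma scal_half_double n (x : H n) : scal (2%:R^-1) * (x + x) = x.
Proof.
have -> : x + x = scal 2%:R * x by rewrite rmorph_nat mulr_natl mulr2n.
by rewrite mulrA -rmorphM mulVf // rmorph1 mul1r.
Qed.

Lemma sigma_super_grading n : super_grading (@sigma_parity n).
Proof.
rewrite /sigma_parity; split=> [b|b x y Ex Ey|b a x Ex||b c x y Ex Ey|x|x].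
- by rewrite rmorph0 mulr0.
- by rewrite rmorphD Ex Ey mulrDr.
- by rewrite rmorphM sigma_scal Ex (mulrA (scal a)) scalC -mulrA.
- by rewrite rmorph1 mulr1.
- rewrite rmorphM Ex Ey; case: b {Ex}; case: c {Ey}; rewrite /= ?expr0 ?expr1 ?mul1r ?mulN1r.
  + by rewrite mulrNN.
  + by rewrite mulNr.
  + by rewrite mulrN.
  + by [].
- exists (scal (2%:R^-1) * (x + sigma n x)), (scal (2%:R^-1) * (x - sigma n x)); split.
  + by rewrite rmorphM sigma_scal rmorphD sigmaK addrC mul1r.
  + by rewrite rmorphM sigma_scal rmorphB sigmaK expr1 mulN1r -mulrN opprB.
  + by rewrite -mulrDr addrACA subrr addr0 scal_half_double.
- rewrite mul1r expr1 mulN1r => -> /eqP; rewrite -addr_eq0 => /eqP xx.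
  by rewrite -(scal_half_double x) xx mulr0.
Qed.

Lemma sigma_homogeneous_basis n :
  exists d (b : 'I_d -> H n), homogeneous_basis (@sigma_parity n) b.
Proof.
have [I [b [bs bspan bfree]]] := homogeneous_tower_basis n.
have re (c : I -> K) : \sum_i scal (c i) * b i =
    \sum_(j < #|I|) scal (c (enum_val j)) * b (enum_val j).
  rewrite (reindex (enum_val : 'I_#|I| -> I)) //.
  by exists (@enum_rank I) => i _; [exact: enum_valK|exact: enum_rankK].
exists #|I|, (fun j => b (enum_val j)); split=> [i|x]; first exact: bs.
have [c ->] := bspan x; exists (\row_j c (enum_val j)); split.
  by rewrite re; apply: eq_bigr => j _; rewrite mxE.
move=> v; rewrite re => E; apply/rowP => j; rewrite mxE; apply/eqP.
rewrite -subr_eq0; apply/eqP.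
pose f i := c i - v 0 (enum_rank i).
have := bfree f _ (enum_val j); rewrite /f enum_valK; apply.
rewrite re; under eq_bigr => k _ do rewrite enum_valK rmorphB mulrBl.
by rewrite sumrB E subrr.
Qed.

Hypotheses (q_neq0 : q != 0) (q_addV : q + q^-1 != 0).

Lemma mulr_prod_one_X_inj n (x : H n) :
  (forall i, (i < n)%N -> 1 + q ^+ i.+1.*2 != 0) ->
  x * prod_one_X n = 0 -> x = 0.
Proof.
move=> qn; have : forall k, (k <= n)%N ->
    x * \prod_(0 <= i < k) (1 + Xi n i) = 0 -> x = 0; last by apply.
elim=> [|k IH] kn; first by rewrite big_geq // mulr1.
rewrite big_nat_recr //= mulrA => xk; apply: (IH (ltnW kn)).
apply: (mulr_one_X_inj (hs n) char2 q_neq0 q_addV kn _ xk) => i ik; apply: qn; lia.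
Qed.

Lemma tower_symmetric n : (forall i, (i < n)%N -> 1 + q ^+ i.+1.*2 != 0) ->
  symmetric_superalgebra (@sigma_parity n) (fun x => tau (x * prod_one_X n)).
Proof.
move=> qn; split; first exact: sigma_super_grading.
  exact: sigma_homogeneous_basis.
have tD (x y : H n) : tau ((x + y) * prod_one_X n) =
    tau (x * prod_one_X n) + tau (y * prod_one_X n).
  by rewrite mulrDl tauD.
have tZ a (x : H n) : tau (scal a * x * prod_one_X n) = a * tau (x * prod_one_X n).
  by rewrite -mulrA tau_scal.
have t0 : tau (0 * prod_one_X n) = 0 by rewrite mul0r tau0.
have tsum I (r : seq I) (F : I -> H n) :
    tau ((\sum_(i <- r) F i) * prod_one_X n) = \sum_(i <- r) tau (F i * prod_one_X n).
  by apply: (big_morph (fun x => tau (x * prod_one_X n))).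
split=> // [x ox|d b [bh bb]|]; last exact: tau_trace.
(* Both tau and z are invariant under parity, while an odd x changes sign. *)
- have : tau (x * prod_one_X n) = - tau (x * prod_one_X n).
    by rewrite -[LHS]tau_sigma rmorphM ox sigma_prod_one_X expr1 mulN1r mulNr tauN.
  move/eqP; rewrite -addr_eq0 -mulr2n -mulr_natl mulf_eq0 (negbTE char2).
  by move/eqP.
(* A row vector killed by the matrix is the coordinate vector of some x orthogonal to every y. By
   the trace property tau(y x z) = 0 for all y, so x z = 0, x = 0, and uniqueness of the coordinates
   of 0 gives v = 0. *)
- rewrite -row_free_unit; apply: inj_row_free => v vM.
  pose x := \sum_i scal (v 0 i) * b i.
  have xb j : tau (x * b j * prod_one_X n) = 0.
    rewrite mulr_suml tsum; under eq_bigr => i _ do rewrite -(mulrA (scal _)) tZ.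
    have := congr1 (fun w : 'rV_d => w 0 j) vM; rewrite !mxE => E; rewrite -[RHS]E.
    by apply: eq_bigr => i _; rewrite mxE.
  have xy y : tau (x * y * prod_one_X n) = 0.
    have [c [-> _]] := bb y; rewrite mulr_sumr tsum big1 // => j _.
    by rewrite mulrA -scalC -mulrA tZ xb mulr0.
  have x0 : x = 0.
    apply: (mulr_prod_one_X_inj qn); apply: tau_nondeg => y.
    by rewrite mulrA -tau_trace xy.
  have [c [_ cu]] := bb 0.
  rewrite -(cu v) //; apply: cu.
  by rewrite big1 // => i _; rewrite mxE rmorph0 mul0r.
Qed.

End Tower.

Lemma free_lift_parity (K : fieldType) (G : choiceType) (A : centralAlgType K)
    (gen : G -> A) (par : G -> bool) (f : {rmorphism A -> A}) b (y : free_alg K G) :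
  (forall a, f (scal a) = scal a) -> (forall g, f (gen g) = (-1) ^+ par g * gen g) ->
  (forall w, w \in msupp y -> odd (count par w) = b) ->
  f (free_lift gen y) = (-1) ^+ b * free_lift gen y.
Proof.
move=> fs fg yb; rewrite rmorph_sum mulr_sumr !big_seq.
apply: eq_bigr => w /yb <-; rewrite signr_odd rmorphM fs mulrA -scalC -mulrA.
congr (_ * _); elim: (w : seq _) => [|g s IH].
  by rewrite !big_nil rmorph1 mulr1.
rewrite !big_cons rmorphM fg IH /= exprD -!mulrA; congr (_ * _).
by rewrite !mulrA; congr (_ * _); apply/commrX/commrN1.
Qed.

(** * The Hecke-Clifford algebra *)

Section Instance.
Variables (K : fieldType) (q : K).
Definition hecke_alg n : centralAlgType K := HeckeClifford q n.
Local Notation T := (@hecke_T K q : forall n, nat -> hecke_alg n).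
Local Notation C := (@hecke_C K q : forall n, nat -> hecke_alg n).

Lemma hecke_alg_system n : hc_system q n (T n) (C n).
Proof. exact: hecke_system. Qed.

Lemma hecke_alg_lift n (A : centralAlgType K) (T' C' : nat -> A) :
  hc_system q n T' C' -> exists f : {rmorphism hecke_alg n -> A},
  [/\ forall a, f (scal a) = scal a, forall i, (i.+1 < n)%N -> f (T n i) = T' i &
      forall i, (i < n)%N -> f (C n i) = C' i].
Proof.
move=> hc; have [f [fs fg]] := hecke_lift hc; exists f; split=> // i li.
  have li' : (i < n.-1)%N by lia.
  by have := fg (HT (Ordinal li')); rewrite hecke_TE.
by have := fg (HC (Ordinal li)); rewrite hecke_CE.
Qed.

Lemma hecke_alg_ind n (P : hecke_alg n -> Prop) : P 1 ->
  (forall x y, P x -> P y -> P (x + y)) ->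
  (forall a x, P x -> P (scal a * x)) ->
  (forall i x, (i.+1 < n)%N -> P x -> P (T n i * x)) ->
  (forall i x, (i < n)%N -> P x -> P (C n i * x)) ->
  forall x, P x.
Proof. exact: hecke_ind. Qed.

Local Notation inc := (inc hecke_alg_system hecke_alg_lift).
Local Notation sigma := (sigma hecke_alg_system hecke_alg_lift).
Local Notation eps := (eps hecke_alg_system hecke_alg_lift).
Local Notation tau := (tau hecke_alg_system hecke_alg_ind hecke_alg_lift).

Lemma hecke_inclE m : @hecke_incl K q m =1 inc m.
Proof.
have [f fE [fs fg]] := hecke_incl_rmorphism q m => x; rewrite fE.
apply: (@inc_unique _ _ _ _ _ hecke_alg_system hecke_alg_ind hecke_alg_lift m f) => // i li.
  have li' : (i < m.-1)%N by lia.
  rewrite -[hecke_T q m i](hecke_TE q (Ordinal li')) fg.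
  exact: (hecke_TE q (widen_ord (leq_pred m) (Ordinal li') : 'I_m.+1.-1)).
rewrite -[hecke_C q m i](hecke_CE q (Ordinal li)) fg.
exact: (hecke_CE q (widen_ord (leqnSn m) (Ordinal li))).
Qed.

Lemma HTH_xTy m i x y : i.+1 = m -> hecke_HTH (inc m x * T m.+1 i * inc m y).
Proof.
move=> im; have im' : (i < m)%N by lia.
rewrite -!hecke_inclE -[hecke_T q m.+1 i](hecke_TE q (Ordinal im' : 'I_m.+1.-1)).
exact: hecke_HTH_in.
Qed.

Lemma eps_HTH m z : @hecke_HTH K q m z -> eps z = 0.
Proof.
elim=> {z} [|x y _ Ex _ Ey|i x y im].
- by rewrite -(mul0r (1 : hecke_alg m.+1)) -(rmorph0 scal) eps_scal rmorph0 mul0r.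
- by rewrite epsD Ex Ey addr0.
- rewrite !hecke_inclE (hecke_TE q (i : 'I_m.+1.-1)).
  case: m i x y im => [|m] i x y im; first by case: i im.
  case: im => ->.
  exact: (eps_xTy hecke_alg_system hecke_alg_ind hecke_alg_lift).
Qed.

(** By [decomp] a decomposition exists, so [xget] returns a genuine component and not its default;
    [eps_decomp] identifies it. *)
Lemma hecke_epsE m h : @hecke_eps K q m h = eps h.
Proof.
rewrite /hecke_eps; set S := (X in xget _ X).
have [a [z [b [Ez E]]]] := decomp hecke_alg_ind
  (@hecke_HTH0 K q m) (@hecke_HTHD K q m) (@HTH_xTy m) h.
have Sa : S a.
  by exists z, b; split; [exact: Ez|rewrite !hecke_inclE (hecke_CE q ord_max); exact: E].
have [{}z [{}b [{}Ez {}E]]] := xgetI 0 Sa.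
apply/esym/(@eps_decomp _ _ _ _ _ hecke_alg_system hecke_alg_ind hecke_alg_lift m
  (@hecke_HTH K q m)).
  exact: eps_HTH.
exists z, b; split; first exact: Ez.
by move: E; rewrite !hecke_inclE (hecke_CE q ord_max).
Qed.

Lemma hecke_tauE n h : @hecke_tau K q n h = tau h.
Proof.
elim: n h => [|n IH] h; last by rewrite /= hecke_epsE IH.
rewrite /= /hecke_val0; have E := val0K hecke_alg_ind h.
have Sa : [set c | h = scal c]%classic (val0 hecke_alg_ind h) by exact: esym E.
have Sx := xgetI 0 Sa.
by apply: (scal0_inj hecke_alg_lift); exact: (etrans (esym Sx) (esym E)).
Qed.

Lemma prod_one_XE n : \prod_(i < n) (1 + hecke_gen q (HX i)) = prod_one_X q T C n.
Proof. by rewrite /prod_one_X big_mkord; apply: eq_bigr => i _; rewrite hecke_X. Qed.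

Lemma hecke_tE n h : @hecke_t K q n h = tau (h * prod_one_X q T C n).
Proof. by rewrite /hecke_t hecke_tauE prod_one_XE. Qed.

Lemma sigma_gen n g : sigma n (hecke_gen q g) = (-1) ^+ hc_gen_parity g * hecke_gen q g.
Proof.
case: g => i /=; rewrite ?expr0 ?expr1 ?mul1r ?mulN1r.
- by rewrite hecke_TE sigma_T //; have := ltn_ord i; lia.
- by rewrite hecke_X; exact: (sigma_X hecke_alg_system hecke_alg_lift (ltn_ord i)).
- by rewrite hecke_XV; exact: (sigma_XV hecke_alg_system hecke_alg_lift (ltn_ord i)).
- by rewrite hecke_CE; exact: (sigma_C hecke_alg_system hecke_alg_lift (ltn_ord i)).
Qed.

Lemma sigma_free_parity n b (y : free_alg K (hc_gen n)) :
  free_parity b y -> sigma n (hecke_pi q y) = (-1) ^+ b * hecke_pi q y.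
Proof.
move=> yb; rewrite hecke_piE.
apply: (free_lift_parity (f := sigma n)) yb => [a|g]; last exact: sigma_gen.
exact: sigma_scal.
Qed.

Lemma free_parity_split (n : nat) (y : free_alg K (hc_gen n)) :
  exists y0 y1, [/\ free_parity false y0, free_parity true y1 & y = y0 + y1].
Proof.
pose part c := \sum_(w <- msupp y | odd (count (@hc_gen_parity n) w) == c) << y@_w *g w >>.
have pp c : free_parity c (part c).
  move=> w; apply: contraTeq => wc; rewrite -mcoeff_eq0 raddf_sum big1 // => w' /eqP w'c.
  by rewrite /= mcoeffU; case: eqP => // E; rewrite -E w'c eqxx in wc.
exists (part false), (part true); split => //.
rewrite [LHS]monalgE (bigID (fun w : {fmonom (hc_gen n)} =>
  odd (count (@hc_gen_parity n) w) == false)) /=.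
by congr (_ + _); apply: eq_bigl => w; case: odd.
Qed.

(** For the converse, split a representative into even and odd words: the image of the wrong part
    equals its own negative, hence is 0. *)
Lemma hecke_parityE n b x : 2%:R != 0 :> K ->
  @hecke_parity K q n b x <-> sigma_parity hecke_alg_system hecke_alg_lift b x.
Proof.
move=> char2; split=> [[y [yb ->]]|sx]; first exact: sigma_free_parity.
have [y xy] := hecke_repr x; have [y0 [y1 [p0 p1 yE]]] := free_parity_split y.
have xE : x = hecke_pi q y0 + hecke_pi q y1 by rewrite xy yE /hecke_pi !rmorphD.
have half (z : hecke_alg n) : z + z = 0 -> z = 0.
  by move=> z2; rewrite -(scal_half_double char2 z) z2 mulr0.
have s0 := sigma_free_parity p0; have s1 := sigma_free_parity p1.
rewrite expr0 mul1r in s0; rewrite expr1 mulN1r in s1.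
move: sx; rewrite /sigma_parity xE rmorphD s0 s1; case: b.
- rewrite expr1 mulN1r opprD => /addIr /eqP; rewrite -addr_eq0 => /eqP /half z0.
  by exists y1; split; rewrite // z0 add0r.
- rewrite expr0 mul1r => /addrI /eqP; rewrite eq_sym -addr_eq0 => /eqP /half z0.
  by exists y0; split; rewrite // z0 addr0.
Qed.

End Instance.

Theorem proposition1p3 (K : closedFieldType) (q : K) (n : nat)
    (charK : 2%N \notin [pchar K])
    (q_neq0 : q != 0) (q_neq1 : q != 1) (q_neqN1 : q != -1)
    (q_addV : q + q^-1 != 0)
    (q_root : forall l : nat, (1 <= l <= n)%N ->
       ~~ (4 * l)%N.-primitive_root q) :
  symmetric_superalgebra (@hecke_parity K q n) (@hecke_t K q n).
Proof.
have char2 : 2%:R != 0 :> K by move: charK; rewrite inE.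
(* Otherwise q would be a primitive 4l-th root of unity with l <= i+1 <= n. *)
have qn i : (i < n)%N -> 1 + q ^+ i.+1.*2 != 0.
  move=> li; apply/negP; rewrite addrC addr_eq0 => /eqP E.
  have [l /andP[l1 li'] ql] := primitive_rootN1 char2 (ltn0Sn i) E.
  by have := q_root l; rewrite l1 (leq_trans li' li) ql => /(_ isT).
have -> : @hecke_parity K q n =
    @sigma_parity K q _ _ _ (@hecke_alg_system K q) (@hecke_alg_lift K q) n.
  by apply/funext => b; apply/funext => x; apply/propext/hecke_parityE.
have -> : @hecke_t K q n = (fun h : hecke_alg q n =>
    tau (@hecke_alg_system K q) (@hecke_alg_ind K q) (@hecke_alg_lift K q)
      (h * prod_one_X q (@hecke_T K q) (@hecke_C K q) n)).
  by apply/funext => h; exact: hecke_tE.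
exact: (tower_symmetric (@hecke_alg_system K q) (@hecke_alg_ind K q) (@hecke_alg_lift K q)).
Qed.
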